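(* Let $U\in L^\infty(\mathbb{R})$ and $V\in L^\infty(\mathbb{R})\cap W_2^1(\mathbb{R})$ be real-valued functions of compact support, and let $\{\alpha_\lambda\}_{\lambda>0}$ be positive numbers with $\alpha_\lambda\to\alpha$ as $\lambda\to0$ for some $\alpha>0$. Let $H_\lambda=-\frac{d^2}{dx^2}+U(x)+\lambda\alpha_\lambda V(\alpha_\lambda x)$ on $W_2^2(\mathbb{R})$ and $H_0=-\frac{d^2}{dx^2}+U$. Suppose $H_0$ has a zero-energy resonance with normalized half-bound state $u$, and let $\theta=\lim_{x\to+\infty}u(x)$. If $$\int_{\mathbb{R}}V(\alpha x)u^2(x)\,dx=0,\qquad \int_{\mathbb{R}}xV'(\alpha x)u^2(x)\,dx<0,$$ and $\lambda^{-1/3}(\alpha_\lambda-\alpha)\to\infty$ as $\lambda\to0$, then $H_\lambda$ has the coupling constant threshold $\lambda=0$, and the threshold eigenvalue satisfies $$e_\lambda=-\lambda^2(\alpha_\lambda-\alpha)^2\left(\Big(\frac{\alpha}{\theta^2+1}\int_{\mathbb{R}}xV'(\alpha x)u^2(x)\,dx\Big)^2+o(1)\right)\quad\text{as }\lambda\to0.$$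
   Context: $H_0$ possesses a zero-energy resonance if there is a nontrivial solution $h$ of $-h''+Uh=0$ bounded on $\mathbb{R}$ (a half-bound state); its limits $h_\pm=\lim_{x\to\pm\infty}h(x)$ exist and are nonzero, and the normalized half-bound state is $u=h/h_-$ (so $u\to1$ as $x\to-\infty$). The coupling constant threshold $\lambda=0$ means: for all small $\lambda>0$, $H_\lambda$ has a negative eigenvalue $e_\lambda$ (below the essential spectrum $[0,\infty)$) with $e_\lambda\to0$ as $\lambda\to0$. *)

(* Defs.v *)
From HB Require Import structures.
From mathcomp Require Import all_boot all_order all_algebra.
From mathcomp Require Import all_classical all_reals all_analysis.
Set Implicit Arguments. Unset Strict Implicit. Unset Printing Implicit Defensive.
Import Order.TTheory GRing.Theory Num.Theory.
Import numFieldNormedType.Exports.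
Local Open Scope classical_set_scope.
Local Open Scope ring_scope.

Notation leb R := (@lebesgue_measure R).

Definition rmeas (R : realType) (f : R -> R) : Prop := measurable_fun setT f.

(* f in L^infinity, represented by a bounded measurable representative *)
Definition Linfty (R : realType) (f : R -> R) : Prop :=
  rmeas f /\ exists M : R, forall x, `|f x| <= M.

Definition compact_support (R : realType) (f : R -> R) : Prop :=
  exists r : R, forall x, r < `|x| -> f x = 0.

Definition L2 (R : realType) (f : R -> R) : Prop :=
  rmeas f /\ (leb R).-integrable setT (fun x => ((f x) ^+ 2)%:E).

Definition AC_with_deriv (R : realType) (g dg : R -> R) : Prop :=
  (forall x y : R, x <= y -> (leb R).-integrable `[x, y] (EFin \o dg)) /\
  (forall x y : R, x <= y -> g y - g x = \int[leb R]_(t in `[x, y]) dg t).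

(* f in W_2^1(R): (the continuous representative of) f is absolutely
   continuous, and f, f' are in L^2. *)
Definition W21_with_deriv (R : realType) (f df : R -> R) : Prop :=
  L2 f /\ L2 df /\ AC_with_deriv f df.

(* h is a (Caratheodory) solution of  - h'' + W h = E h  on R:
   h is C^1 with derivative dh, and dh is absolutely continuous with
   dh' = (W - E) h a.e. *)
Definition sturm_solution (R : realType) (W : R -> R) (E : R) (h dh : R -> R)
  : Prop :=
  (forall x, is_derive (x : R) (1 : R) h (dh x)) /\
  AC_with_deriv dh (fun x => (W x - E) * h x).

(* E is an eigenvalue of H = - d^2/dx^2 + W on the domain W_2^2(R):
   there is a nonzero psi in W_2^2(R) with - psi'' + W psi = E psi. *)
Definition is_eigenvalue (R : realType) (W : R -> R) (E : R) : Prop :=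
  exists psi dpsi : R -> R,
    sturm_solution W E psi dpsi /\
    L2 psi /\ L2 dpsi /\ L2 (fun x => (W x - E) * psi x) /\
    exists x, psi x != 0.

(* u is the normalized half-bound state of H_0 = - d^2/dx^2 + U, i.e.
   H_0 has a zero-energy resonance: u is a bounded solution of
   - u'' + U u = 0 with u(x) -> 1 as x -> -oo. *)
Definition normalized_half_bound_state (R : realType) (U u : R -> R) : Prop :=
  (exists du, sturm_solution U 0 u du) /\
  (exists M : R, forall x, `|u x| <= M) /\
  u x @[x --> -oo] --> (1 : R).

(* Main.v *)
(* Let [r] be so large that [U] and the dilated potentials [V (s x)], [s] near [a],
   vanish for [|x| >= r]; there [u] is constant. For [k > 0] let [p] solve
   [p'' = (U + eps V(s x) + k ^ 2) p] with [p (- r) = 1], [p' (- r) = k], where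
   [s = alpha l] and [eps = l s]. Then [- k ^ 2] is an eigenvalue as soon as
   [F k = p' r + k p r] vanishes, since [p] matches decaying exponentials on both
   sides. Comparing [p] with [u] through their Wronskian gives
     theta F k = k (1 + theta ^ 2) + eps \int V (s x) u ^ 2 + O ((k + eps) ^ 2).
   Integrating by parts against a primitive of [V], the integral expands as
     s \int V (s x) u ^ 2 = (s - a) (a \int x V' (a x) u ^ 2 + o(1)).
   As [l = o(s - a)], the rescaled unknown [k / (l (s - a))] has by the intermediate
   value theorem a root near [- a / (1 + theta ^ 2) \int x V' (a x) u ^ 2 > 0]. *)
Require Import Defs.
From HB Require Import structures.
From mathcomp Require Import all_boot all_order all_algebra.
From mathcomp Require Import all_classical all_reals all_analysis.
From mathcomp Require Import measurable_realfun ring lra.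
Set Implicit Arguments. Unset Strict Implicit. Unset Printing Implicit Defensive.
Import Order.TTheory GRing.Theory Num.Theory.
Import numFieldNormedType.Exports.
Local Open Scope classical_set_scope.
Local Open Scope ring_scope.

(** The data are rough: [U] is only bounded, and [V'] is square integrable and determined only
    almost everywhere. So every equation is kept as an integral identity [AC_with_deriv], and the
    product rule, the initial value problem and the expansion in [s] are treated at that level. This
    is why a primitive [P] of [V] enters: [P] has the uniformly continuous derivative [V], so
    [P (s x)] expands to first order in [s] with an error uniform in [x], whereas expanding
    [V (s x)] would require pointwise control of [V']. The potential [V (alpha l x)] moves with [l],
    so the constant in the O must depend on sup norms only. Dividing by [theta] is possible because
    [u] and [u'] cannot vanish together at [r]. For [k] of order [l (s - a)] the quadratic error is
    O(l ^ 2), hence o(l (s - a)). The root is not claimed to be unique: one is chosen for each [l]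
    together with the estimate it satisfies, and the asymptotics follow from that estimate whichever
    root was chosen. *)

Definition Int (R : realType) (f : R -> R) (x y : R) : R :=
  \int[leb R]_(t in `[x, y]) f t.

(** No order of [x] and [y] is imposed: for [y < x] the interval is empty and [Int f x y] is 0. *)
Definition locint (R : realType) (f : R -> R) :=
  forall x y : R, (leb R).-integrable `[x, y] (EFin \o f).

Definition locbnd (R : realType) (f : R -> R) :=
  forall x y : R, exists M : R, forall t, x <= t <= y -> `|f t| <= M.

(** * Integration over compact intervals *)

Section locint.
Context {R : realType}.
Implicit Types (f g : R -> R) (x y z : R).

Lemma locint_locbnd f : rmeas f -> locbnd f -> locint f.
Proof.
move=> mf bf x y; have [M fM] := bf x y.
apply: measurable_bounded_integrable => //.
- by rewrite /= lebesgue_measure_itv; case: ifP => _; rewrite ?ltry.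
- exact: measurable_funTS.
- exists M; split; first by rewrite num_real.
  move=> N MN t /=; rewrite in_itv/= => xty.
  by rewrite (le_trans (fM _ xty))// ltW.
Qed.

Lemma continuous_locbnd f : continuous f -> locbnd f.
Proof.
move=> cf x y; have [xy|yx] := leP x y; last first.
  by exists 0 => t /andP[xt ty]; move: (le_trans xt ty); rewrite leNgt yx.
have cfn : {within `[x, y], continuous (fun t => `|f t|)}.
  apply: continuous_subspaceT => t.
  apply: continuous_comp; [exact: cf|exact: norm_continuous].
have [c _ fc] := EVT_max xy cfn.
by exists `|f c| => t txy; apply: fc; rewrite in_itv.
Qed.

Lemma continuous_rmeas f : continuous f -> rmeas f.
Proof. exact: continuous_measurable_fun. Qed.

Lemma continuous_locint f : continuous f -> locint f.
Proof.
move=> cf; apply: locint_locbnd; first exact: continuous_rmeas.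
exact: continuous_locbnd.
Qed.

Lemma locintM f g : locint f -> rmeas g -> locbnd g -> locint (fun t => f t * g t).
Proof.
move=> lf mg bg x y; have [M gM] := bg x y.
have mgxy : measurable_fun `[x, y] g by exact: measurable_funTS.
have bgxy : [bounded g t | t in `[x, y]%classic].
  exists M; split; first by rewrite num_real.
  move=> N MN t /=; rewrite in_itv/= => xty.
  by rewrite (le_trans (gM _ xty))// ltW.
have := integrableMl _ (lf x y) mgxy bgxy => /(_ (measurable_itv _)).
by apply: eq_integrable => // t _; rewrite /= EFinM.
Qed.

Lemma locintMc f g : locint f -> continuous g -> locint (fun t => f t * g t).
Proof.
move=> lf cg; apply: locintM => //; first exact: continuous_rmeas.
exact: continuous_locbnd.
Qed.

Lemma locintD f g : locint f -> locint g -> locint (fun t => f t + g t).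
Proof.
move=> lf lg x y.
exact: (integrableD _ (lf x y) (lg x y)).
Qed.

Lemma locint_cst (k : R) : locint (fun=> k).
Proof. by apply: continuous_locint => x; exact: cvg_cst. Qed.

Lemma locintZ k f : locint f -> locint (fun t => k * f t).
Proof.
move=> lf x y.
exact: (integrableZl _ k (lf x y)).
Qed.

Lemma locintB f g : locint f -> locint g -> locint (fun t => f t - g t).
Proof.
move=> lf lg x y.
exact: (integrableB _ (lf x y) (lg x y)).
Qed.

Lemma locint_norm f : locint f -> locint (fun t => `|f t|).
Proof.
move=> lf x y; exact: (integrable_norm (lf x y)).
Qed.

Lemma IntD f g x y : locint f -> locint g ->
  Int (fun t => f t + g t) x y = Int f x y + Int g x y.
Proof. by move=> lf lg; rewrite /Int RintegralD. Qed.

Lemma IntB f g x y : locint f -> locint g ->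
  Int (fun t => f t - g t) x y = Int f x y - Int g x y.
Proof. by move=> lf lg; rewrite /Int RintegralB. Qed.

Lemma IntZ k f x y : locint f -> Int (fun t => k * f t) x y = k * Int f x y.
Proof. by move=> lf; rewrite /Int RintegralZl//; exact: lf. Qed.

Lemma Int_cst k x y : x <= y -> Int (fun=> k) x y = k * (y - x).
Proof.
move=> xy; rewrite /Int Rintegral_cst//; congr (_ * _).
rewrite /= lebesgue_measure_itv/= lte_fin; case: ltP => // yx /=.
by apply/eqP; rewrite eq_sym subr_eq0 eq_le yx.
Qed.

Lemma eq_Int f g x y : (forall t, x <= t <= y -> f t = g t) -> Int f x y = Int g x y.
Proof. by move=> fg; apply: eq_Rintegral => t; rewrite inE/= in_itv/= => /fg. Qed.

Lemma Int_ge0 f x y : (forall t, x <= t <= y -> 0 <= f t) -> 0 <= Int f x y.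
Proof. by move=> f0; apply: Rintegral_ge0 => t /=; rewrite in_itv/= => /f0. Qed.

Lemma le_Int f g x y : locint f -> locint g ->
  (forall t, x <= t <= y -> f t <= g t) -> Int f x y <= Int g x y.
Proof.
by move=> lf lg fg; apply: (le_Rintegral _ (lf x y) (lg x y)) => // t /=; rewrite
    in_itv/= => /fg.
Qed.

Lemma le_norm_Int f g x y : locint f -> locint g ->
  (forall t, x <= t <= y -> `|f t| <= g t) -> `|Int f x y| <= Int g x y.
Proof.
move=> lf lg fg; apply: le_trans (le_normr_Rintegral _ (lf x y)) _ => //.
by apply: le_Int => //; exact: locint_norm.
Qed.

Lemma le_norm_Int_cst f M x y : x <= y -> locint f ->
  (forall t, x <= t <= y -> `|f t| <= M) -> `|Int f x y| <= M * (y - x).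
Proof.
move=> xy lf fM; rewrite -Int_cst//; apply: le_norm_Int => //.
exact: locint_cst.
Qed.

Lemma Int_chasles f x y z : locint f -> x <= y <= z ->
  Int f x z = Int f x y + Int f y z.
Proof.
move=> lf /andP[xy yz].
have := @Rintegral_itvB R f (BLeft x) (BRight z) y (lf x z).
rewrite !bnd_simp => /(_ xy yz) H.
rewrite /Int -[in X in _ + X]Rintegral_itv_obnd_cbnd; first by rewrite -H addrC subrK.
apply: integrableS (lf y z) => //.
by apply: subset_itvr; rewrite bnd_simp.
Qed.

Lemma Intxx f x : Int f x x = 0.
Proof. by rewrite /Int set_itv1 Rintegral_set1. Qed.

Lemma integral_compact_support f r : 0 <= r -> (forall t, r < `|t| -> f t = 0) ->
  \int[leb R]_x f x = Int f (- r) r.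
Proof.
move=> r0 f0; rewrite /Int [RHS]Rintegral_mkcond; apply: eq_Rintegral => t _.
rewrite patchE; case: ifPn => //; rewrite notin_setE/= in_itv/= => /negP.
by rewrite -ler_norml -ltNge => /f0.
Qed.

End locint.

(** * Sequences with geometrically decreasing increments *)

Section geometric.
Context {R : realType}.

Lemma geometric_eq0 (a C : R) : (forall n, `|a| <= C / 2 ^+ n) -> a = 0.
Proof.
move=> H; apply/eqP; rewrite -normr_le0; apply/ler_addgt0Pl => e e0; rewrite addr0.
have cv : C * 2^-1 ^+ n @[n --> \oo] --> C * 0.
  by apply: cvgM; [exact: cvg_cst|apply: cvg_expr; rewrite ger0_norm; lra].
rewrite mulr0 in cv; move/cvgrPdist_lt : cv => /(_ _ e0)[N _ /(_ N (leqnn _))].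
rewrite sub0r normrN => /ltW eN.
apply: le_trans (H N) _; apply: le_trans eN; rewrite exprVn; exact: ler_norm.
Qed.

Lemma geometric_limit (v : nat -> R) (D : R) :
  (forall n, `|v n.+1 - v n| <= D / 2 ^+ n) ->
  exists l, forall n, `|l - v n| <= 2 * D / 2 ^+ n.
Proof.
move=> vD.
have D0 : 0 <= D by have := le_trans (normr_ge0 _) (vD 0%N); rewrite expr0 divr1.
have halve n : D / 2 ^+ n = 2 * (D / 2 ^+ n.+1) by rewrite exprS; field; rewrite
    expf_neq0.
(* The intervals [u n, w n] are nested, so the supremum of the left endpoints lies in all of them;
   no Cauchy argument is needed. *)
pose u n := v n - 2 * D / 2 ^+ n; pose w n := v n + 2 * D / 2 ^+ n.
have uS n : u n <= u n.+1.
  have := vD n; rewrite ler_norml /u -!mulrA => /andP[+ _]; have := halve n; lra.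
have wS n : w n.+1 <= w n.
  have := vD n; rewrite ler_norml /w -!mulrA => /andP[_]; have := halve n; lra.
have um n m : u n <= u (n + m)%N.
  by elim: m => [|m IH]; rewrite ?addn0// addnS (le_trans IH).
have wm n m : w (n + m)%N <= w n.
  by elim: m => [|m IH]; rewrite ?addn0// addnS (le_trans (wS _)).
have uw n m : u n <= w m.
  apply: le_trans (um n m) _; apply: le_trans (wm m n); rewrite addnC /u /w.
  have : 0 <= 2 * D / 2 ^+ (m + n) by rewrite divr_ge0 ?exprn_ge0// mulr_ge0.
  lra.
have ubu : has_ubound (range u) by exists (w 0%N) => _ [n _ <-].
exists (sup (range u)) => n.
have h1 : u n <= sup (range u) by apply: ub_le_sup => //; exists n.
have h2 : sup (range u) <= w n.
  by apply: ge_sup; [exists (u 0%N), 0%N|move=> _ [m _ <-]].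
by move: h1 h2; rewrite /u /w ler_norml => h1 h2; apply/andP; split; lra.
Qed.

End geometric.

(** * Calculus of absolutely continuous functions *)

Section ac.
Context {R : realType}.
Implicit Types (f g df dg : R -> R) (x y z : R).

Lemma AC_locint f df : AC_with_deriv f df -> locint df.
Proof.
move=> [H _] x y; have [/H//|yx] := leP x y.
by rewrite set_itv_ge -?leNgt ?bnd_simp// -?ltNge//; exact: integrable_set0.
Qed.

Lemma AC_Int f df x y : AC_with_deriv f df -> x <= y -> f y - f x = Int df x y.
Proof. by move=> [_ H] /H. Qed.

Lemma AC_intro f df : locint df -> (forall x y, x <= y -> f y - f x = Int df x y) ->
  AC_with_deriv f df.
Proof. by move=> ldf H; split => // *; exact: ldf. Qed.

Lemma eq_AC f g df dg : f =1 g -> df =1 dg -> AC_with_deriv f df -> AC_with_deriv g dg.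
Proof. by move=> /funext -> /funext ->. Qed.

Lemma AC_cst k : AC_with_deriv (fun=> k : R) (fun=> 0).
Proof.
apply: AC_intro; first exact: locint_cst.
by move=> x y xy; rewrite subrr (Int_cst 0 xy) mul0r.
Qed.

Lemma ACD f g df dg : AC_with_deriv f df -> AC_with_deriv g dg ->
  AC_with_deriv (fun x => f x + g x) (fun x => df x + dg x).
Proof.
move=> ff gg; apply: AC_intro.
  exact: (locintD (AC_locint ff) (AC_locint gg)).
move=> x y xy; rewrite (IntD _ _ (AC_locint ff) (AC_locint gg)).
by rewrite -(AC_Int ff xy) -(AC_Int gg xy); ring.
Qed.

Lemma ACB f g df dg : AC_with_deriv f df -> AC_with_deriv g dg ->
  AC_with_deriv (fun x => f x - g x) (fun x => df x - dg x).
Proof.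
move=> ff gg; apply: AC_intro.
  exact: (locintB (AC_locint ff) (AC_locint gg)).
move=> x y xy; rewrite (IntB _ _ (AC_locint ff) (AC_locint gg)).
by rewrite -(AC_Int ff xy) -(AC_Int gg xy); ring.
Qed.

Lemma ACZ k f df : AC_with_deriv f df ->
  AC_with_deriv (fun x => k * f x) (fun x => k * df x).
Proof.
move=> ff; apply: AC_intro; first exact: (locintZ k (AC_locint ff)).
by move=> x y xy; rewrite (IntZ _ _ _ (AC_locint ff)) -(AC_Int ff xy) mulrBr.
Qed.

Lemma AC_continuous f df : AC_with_deriv f df -> continuous f.
Proof.
move=> ff x.
have lf := AC_locint ff.
have xx : x - 1 < x + 1 by lra.
have := parameterized_integral_continuous (ltW xx) (lf (x - 1) (x + 1)).
move=> /(within_continuous_continuous xx) => /(_ x); rewrite in_itv/=.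
have -> : x - 1 < x < x + 1 by lra.
move=> /(_ isT) cx.
have cx' : {for x, continuous (fun t => f (x - 1) + parameterized_integral (leb R) (x -
    1) t df)}.
  by apply: cvgD; [exact: cvg_cst|exact: cx].
apply: (@cvg_trans _ ((fun t => f (x - 1) + parameterized_integral (leb R) (x - 1) t
    df) @ x)).
  apply: near_eq_cvg; near=> t.
  have xt : x - 1 <= t by near: t; apply: lt_le_nbhsr; lra.
  by rewrite /parameterized_integral -/(Int _ _ _) -(AC_Int ff xt); ring.
have -> : f x = f (x - 1) + parameterized_integral (leb R) (x - 1) x df.
  have xt : x - 1 <= x by lra.
  by rewrite /parameterized_integral -/(Int _ _ _) -(AC_Int ff xt); ring.
exact: cx'.
Unshelve. all: by end_near. Qed.

Lemma C1_AC f df : (forall x, is_derive x (1:R) f (df x)) -> continuous df ->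
  AC_with_deriv f df.
Proof.
move=> dff cdf; split; first by move=> x y _; exact: continuous_locint.
move=> x y; rewrite le_eqVlt => /predU1P[->|xy].
  by rewrite subrr -/(Int _ _ _) Intxx.
have cf : continuous f.
  by move=> t; apply: differentiable_continuous; apply/derivable1_diffP; case: (dff t).
rewrite /Rintegral (@continuous_FTC2 _ _ f)//.
- exact: continuous_subspaceT.
- split.
  + by move=> t _; case: (dff t).
  + exact: (cvg_at_right_filter (cf x)).
  + exact: (cvg_at_left_filter (cf y)).
- by move=> t _; rewrite derive1E; case: (dff t).
Qed.

Lemma AC_is_derive f df : AC_with_deriv f df -> continuous df ->
  forall x, is_derive x (1:R) f (df x).
Proof.
move=> ff cdf x.
have lf := AC_locint ff.
have x1 : x < x + 1 by lra.
have x2 : x - 1 < x by lra.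
have [D1 D2] := continuous_FTC1_closed x1 (lf (x - 1) (x + 1)) x2 (cdf x).
apply: (@near_eq_is_derive _ _ _ (fun t => f (x - 1) + Int df (x - 1) t)).
  near=> t.
  have xt : x - 1 <= t by near: t; apply: lt_le_nbhsr; lra.
  by rewrite -(AC_Int ff xt); ring.
rewrite derive1E in D2.
have D : is_derive x (1 : R) (fun t => Int df (x - 1) t) (df x) by split.
by have := is_deriveD (is_derive_cst (f (x - 1)) x 1) D; rewrite add0r.
Unshelve. all: by end_near. Qed.

(** The oriented integral from [A] to [x]; the case split supplies the sign, because [Int] gives 0
    on reversed bounds. *)
Definition prim (A : R) f x := if A <= x then Int f A x else - Int f x A.

Lemma prim_AC A f : locint f -> AC_with_deriv (prim A f) f.
Proof.
move=> lf; apply: AC_intro => // x y xy; rewrite /prim.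
case: (leP A x) => Ax.
  rewrite (le_trans Ax xy) [Int f A y](Int_chasles lf (y := x)); first by ring.
  by rewrite Ax.
case: (leP A y) => Ay; last first.
  by rewrite [Int f x A](Int_chasles lf (y := y)) ?xy ?ltW//; ring.
by rewrite [RHS](Int_chasles lf (y := A)) ?(ltW Ax)//; ring.
Qed.

(* Halving the interval n times gains a factor 2^-n in the bound. *)
Lemma additive_interval_eq0 (Phi mu : R -> R -> R) (C : R) (x y : R) : x <= y -> 0 <= C ->
  (forall s t z, x <= s <= t -> t <= z <= y -> Phi s z = Phi s t + Phi t z) ->
  (forall s t z, x <= s <= t -> t <= z <= y -> mu s z = mu s t + mu t z) ->
  (forall s t, x <= s <= t -> t <= y -> `|Phi s t| <= C * (t - s) * mu s t) ->
  Phi x y = 0.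
Proof.
move=> xy C0 PhiD muD bnd.
have H n : forall s t, x <= s <= t -> t <= y ->
    `|Phi s t| <= C * ((t - s) / 2 ^+ n) * mu s t.
  elim: n => [|n IH] s t /andP[xs st] ty; first by rewrite expr0 divr1 bnd// xs.
  have sm : s <= (s + t) / 2 by lra.
  have mt : (s + t) / 2 <= t by lra.
  rewrite (PhiD s ((s + t) / 2) t) ?xs ?sm ?mt//.
  rewrite (muD s ((s + t) / 2) t) ?xs ?sm ?mt//.
  apply: le_trans (ler_normD _ _) _; rewrite mulrDr; apply: lerD.
    apply: le_trans (IH _ _ _ _) _; rewrite ?xs ?sm//; first exact: le_trans mt ty.
    rewrite le_eqVlt; apply/orP; left; apply/eqP; rewrite exprS.
    by field; rewrite expf_neq0.
  apply: le_trans (IH _ _ _ _) _; rewrite ?mt ?(le_trans xs)//.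
  rewrite le_eqVlt; apply/orP; left; apply/eqP; rewrite exprS.
  by field; rewrite expf_neq0.
apply: (@geometric_eq0 _ _ (C * (y - x) * mu x y)) => n.
apply: le_trans (H n _ _ _ _) _; rewrite ?lexx ?xy//.
by rewrite le_eqVlt; apply/orP; left; apply/eqP; ring.
Qed.

(** The defect [Phi] of the product formula is additive over intervals and equals the integral of
    [df v * (g t - g v)] plus that of [(f s - f v) * dg v]. A bound [L] on [dg] makes [g] Lipschitz,
    so both parts are at most [L * (t - s)] times the integral of [|df|]. The factor [t - s] is what
    [additive_interval_eq0] turns into a vanishing defect. *)
Lemma ACM f g df dg : AC_with_deriv f df -> AC_with_deriv g dg -> locbnd dg ->
  AC_with_deriv (fun x => f x * g x) (fun x => df x * g x + f x * dg x).
Proof.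
move=> ff gg bg.
have cf := AC_continuous ff; have cg := AC_continuous gg.
have lf := AC_locint ff; have lg := AC_locint gg.
have lfg : locint (fun t => df t * g t) by exact: locintMc.
have lgf : locint (fun t => f t * dg t).
  have := locintMc lg cf; congr locint; apply/funext => t; exact: mulrC.
have ll := locintD lfg lgf.
apply: AC_intro => // x y xy.
have [K bgK] := bg x y; pose L : R := `|K|; have L0 : 0 <= L by exact: normr_ge0.
have bgL t : x <= t <= y -> `|dg t| <= L by move=> /bgK /le_trans; apply; exact: ler_norm.
have HL s t : x <= s -> s <= t -> t <= y -> `|g t - g s| <= L * (t - s).
  move=> xs st ty; rewrite (AC_Int gg st); apply: le_norm_Int_cst => // v /andP[sv vt].
  by apply: bgL; rewrite (le_trans xs sv) (le_trans vt ty).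
pose Phi s t := f t * g t - f s * g s - Int (fun t => df t * g t + f t * dg t) s t.
suff : Phi x y = 0 by move/eqP; rewrite subr_eq0 => /eqP.
apply: (@additive_interval_eq0 Phi (fun s t => Int (fun v => `|df v|) s t) (2 * L)) => //.
- by rewrite mulr_ge0.
- move=> s t z /andP[_ st] /andP[tz _].
  by rewrite /Phi (Int_chasles ll (y := t)) ?st//; ring.
- move=> s t z /andP[_ st] /andP[tz _].
  by rewrite [LHS](Int_chasles (locint_norm lf) (y := t)) ?st.
move=> s t /andP[xs st] ty.
have -> : Phi s t = Int (fun v => df v * (g t - g v)) s t + Int (fun v => (f s - f v) *
    dg v) s t.
  have -> : Int (fun v => df v * (g t - g v)) s t = g t * (f t - f s) - Int (fun t =>
      df t * g t) s t.
    rewrite (AC_Int ff st) -(IntZ _ _ _ lf) -(IntB _ _ (locintZ _ lf))//.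
    by apply: eq_Int => v _; ring.
  have -> : Int (fun v => (f s - f v) * dg v) s t = f s * (g t - g s) - Int (fun t => f
      t * dg t) s t.
    rewrite (AC_Int gg st) -(IntZ _ _ _ lg) -(IntB _ _ (locintZ _ lg))//.
    by apply: eq_Int => v _; ring.
  by rewrite /Phi (IntD _ _ lfg lgf); ring.
have lfn := locint_norm lf.
rewrite (_ : 2 * L * _ * _ = L * (t - s) * Int (fun v => `|df v|) s t + L * (t - s) *
    Int (fun v => `|df v|) s t); last by ring.
apply: le_trans (ler_normD _ _) _; apply: lerD.
  rewrite -(IntZ _ _ _ lfn); apply: le_norm_Int.
  - by apply: locintMc => // v; apply: cvgB; [exact: cvg_cst|exact: cg].
  - exact: locintZ.
  move=> v /andP[sv vt]; rewrite normrM mulrC ler_wpM2r//.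
  apply: le_trans (HL v t _ vt ty) _; first exact: le_trans sv.
  by apply: ler_wpM2l; [exact: L0|lra].
have m0 : 0 <= Int (fun v => `|df v|) s t by apply: Int_ge0.
rewrite (_ : L * _ * _ = L * Int (fun v => `|df v|) s t * (t - s)); last by ring.
apply: le_norm_Int_cst => //.
  have cfs : continuous (fun v => f s - f v).
    by move=> v; apply: cvgB; [exact: cvg_cst|exact: cf].
  have := locintMc lg cfs; congr locint; apply/funext => v; exact: mulrC.
move=> v /andP[sv vt]; rewrite normrM mulrC ler_pM//.
  by apply: bgL; rewrite (le_trans xs sv) (le_trans vt ty).
rewrite distrC (AC_Int ff sv).
apply: le_trans (le_norm_Int lf lfn (fun _ _ => lexx _)) _.
rewrite [leRHS](Int_chasles lfn (y := v)) ?sv// lerDl.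
exact: Int_ge0.
Qed.

Lemma AC_glue f df c : locint df ->
  (forall x y, x <= y <= c -> f y - f x = Int df x y) ->
  (forall x y, c <= x <= y -> f y - f x = Int df x y) ->
  AC_with_deriv f df.
Proof.
move=> ldf Hl Hr; apply: AC_intro => // x y xy.
have [yc|cy] := leP y c; first by apply: Hl; rewrite xy.
have [xc|cx] := leP x c; last by apply: Hr; rewrite xy ltW.
rewrite (Int_chasles ldf (y := c)) ?xc ?(ltW cy)//.
by rewrite -Hl ?xc ?lexx// -Hr ?lexx ?ltW//; ring.
Qed.

End ac.

(** * Off-diagonal linear systems of two equations: Gronwall bound and existence *)

Section linear_system.
Context {R : realType}.
Implicit Types (A B K G x t : R).

Lemma AC_expR m s : AC_with_deriv (fun x => expR (m * (x - s))) (fun x => m * expR (m *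
    (x - s)) : R).
Proof.
have ca : continuous (fun x : R => m * (x - s)).
  by move=> x; apply: cvgM; [exact: cvg_cst|apply: cvgB; [exact: cvg_id|exact: cvg_cst]].
apply: C1_AC => [x|].
  have -> : m * expR (m * (x - s)) = expR (m * (x - s)) * m by rewrite mulrC.
  apply: (@is_derive1_comp _ expR (fun x => m * (x - s))).
  have := is_deriveZ m (is_deriveB (is_derive_id x (1 : R)) (is_derive_cst s x (1 : R))).
  by rewrite subr0 /GRing.scale/= mulr1.
move=> x; apply: cvgM; first exact: cvg_cst.
by apply: continuous_comp; [exact: ca|exact: continuous_expR].
Qed.

(* In this weight the Volterra operator of a system with coefficients bounded by
   [K] contracts with ratio 1/2 (Bielecki norm). *)
Definition wt A K x : R := expR (2 * K * (x - A)).

Lemma wt_gt0 A K x : 0 < wt A K x. Proof. exact: expR_gt0. Qed.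

Lemma wt_ge1 A K x : 0 <= K -> A <= x -> 1 <= wt A K x.
Proof. by move=> K0 Ax; rewrite -expR0 ler_expR !mulr_ge0// subr_ge0. Qed.

Lemma continuous_wt A K : continuous (wt A K).
Proof. exact: AC_continuous (AC_expR _ _). Qed.

Lemma le_wt A K x y : 0 <= K -> x <= y -> wt A K x <= wt A K y.
Proof. by move=> K0 xy; rewrite ler_expR ler_wpM2l ?mulr_ge0//; lra. Qed.

Lemma Int_wt A K x : A <= x -> Int (fun t => 2 * K * wt A K t) A x = wt A K x - 1.
Proof.
by move=> Ax; rewrite -(AC_Int (AC_expR _ _) Ax) subrr mulr0 expR0.
Qed.

(** The ratio 1/2 arises because [K * wt] is half the derivative of [wt]. *)
Lemma le_norm_Int_wt f N A K x : 0 <= N -> A <= x -> locint f ->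
  (forall t, A <= t <= x -> `|f t| <= N * (K * wt A K t)) ->
  `|Int f A x| <= N / 2 * wt A K x.
Proof.
move=> N0 Ax lf fN.
have lw : locint (fun t => 2 * K * wt A K t).
  by apply: locintZ; apply: continuous_locint; exact: continuous_wt.
apply: (@le_trans _ _ (Int (fun t => N / 2 * (2 * K * wt A K t)) A x)).
  apply: le_norm_Int => //; first exact: locintZ.
  by move=> t /fN /le_trans; apply; rewrite le_eqVlt; apply/orP; left; apply/eqP; field.
by rewrite IntZ// Int_wt// ler_wpM2l ?divr_ge0//; lra.
Qed.

(** A bound [N * wt] on both components improves itself to [(G + N / 2) * wt], and [N = 2 * G] is
    the fixed point of this improvement. Continuity on [A, B] gives a crude first bound [M], whose
    contribution is halved in each round. *)
Lemma gronwall A B K G (c z : bool -> R -> R) : 0 < K -> 0 <= G ->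
  (forall b, rmeas (c b)) -> (forall b t, `|c b t| <= K) ->
  (forall b, continuous (z b)) ->
  (forall b x, A <= x <= B -> `|z b x - Int (fun t => c b t * z (~~ b) t) A x| <= G) ->
  forall b x, A <= x <= B -> `|z b x| <= 2 * G * wt A K x.
Proof.
move=> K0 G0 mc cK cz zG b0 x0 xAB0.
have lc b : locint (c b) by apply: locint_locbnd => // s t; exists K.
have lcz b : locint (fun t => c b t * z (~~ b) t) by apply: locintMc.
have [M1 HM1] := continuous_locbnd (cz true) A B.
have [M2 HM2] := continuous_locbnd (cz false) A B.
pose M := `|M1| + `|M2|.
have M0 : 0 <= M by rewrite addr_ge0.
have zM b x : A <= x <= B -> `|z b x| <= M.
  case: b => [/HM1|/HM2] /le_trans; apply; rewrite /M.
    by apply: le_trans (ler_norm _) _; rewrite lerDl.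
  by apply: le_trans (ler_norm _) _; rewrite lerDr.
have H n : forall b x, A <= x <= B -> `|z b x| <= (2 * G + M / 2 ^+ n) * wt A K x.
  elim: n => [|n IH] b x xAB.
    have /andP[Ax _] := xAB.
    rewrite expr0 divr1; apply: le_trans (zM _ _ xAB) _.
    rewrite -[leLHS]mulr1; apply: ler_pM => //; last exact: wt_ge1 (ltW K0) Ax.
    by rewrite lerDr mulr_ge0.
  have /andP[Ax xB] := xAB.
  have N0 : 0 <= 2 * G + M / 2 ^+ n by rewrite addr_ge0 ?mulr_ge0 ?divr_ge0 ?exprn_ge0.
  have HI : `|Int (fun t => c b t * z (~~ b) t) A x| <= (2 * G + M / 2 ^+ n) / 2 * wt A
      K x.
    apply: le_norm_Int_wt => // t /andP[At tx].
    rewrite normrM mulrCA; apply: ler_pM => //; apply: IH.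
    by rewrite At (le_trans tx).
  have -> : z b x = (z b x - Int (fun t => c b t * z (~~ b) t) A x)
                    + Int (fun t => c b t * z (~~ b) t) A x by ring.
  apply: le_trans (ler_normD _ _) _.
  apply: le_trans (lerD (zG _ _ xAB) HI) _.
  have w1 := wt_ge1 (ltW K0) Ax.
  have -> : M / 2 ^+ n.+1 = M / 2 ^+ n / 2 by rewrite exprS; field; rewrite expf_neq0.
  have : G * 1 <= G * wt A K x by rewrite ler_wpM2l.
  lra.
apply/ler_addgt0Pr => e e0.
have cv : M * wt A K x0 * 2^-1 ^+ n @[n --> \oo] --> M * wt A K x0 * 0.
  by apply: cvgM; [exact: cvg_cst|apply: cvg_expr; rewrite ger0_norm; lra].
rewrite mulr0 in cv; move/cvgrPdist_lt : cv => /(_ _ e0)[N _ /(_ N (leqnn _))].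
rewrite sub0r normrN exprVn => /ltW eN.
apply: le_trans (H N _ _ xAB0) _; rewrite mulrDl lerD2l.
apply: le_trans eN; apply: le_trans (ler_norm _).
by rewrite mulrAC.
Qed.

(** The coefficients below vanish only strictly to the left of [A], so the right endpoint has to be
    discarded as a null set. *)
Lemma eq_Int_lt (f g : R -> R) x y : locint f -> locint g ->
  (forall t, x <= t < y -> f t = g t) -> Int f x y = Int g x y.
Proof.
move=> lf lg fg.
rewrite /Int -!Rintegral_itv_bndo_bndc.
- by apply: eq_Rintegral => t; rewrite inE/= in_itv/= => /fg.
- by apply: integrableS (lg x y) => //; apply: subset_itvl; rewrite bnd_simp.
- by apply: integrableS (lf x y) => //; apply: subset_itvl; rewrite bnd_simp.
Qed.

Lemma prim_lt A (f : R -> R) x : locint f -> (forall t, t < A -> f t = 0) -> x < A ->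
  prim A f x = 0.
Proof.
move=> lf f0 xA; rewrite /prim leNgt xA/= (@eq_Int_lt _ (fun=> 0))//.
- by rewrite Int_cst ?mul0r ?oppr0 ?ltW.
- exact: locint_cst.
- by move=> t /andP[_ /f0].
Qed.

(** Picard iteration in the weight [wt]. As the coefficients vanish to the left of [A], all iterates
    are constant there and the estimates hold on the whole line. The limit is measurable, being a
    pointwise limit of continuous functions, and locally bounded; this suffices to integrate it and
    to pass to the limit in the integral equation. *)
Lemma linear_system_solution A K (c : bool -> R -> R) (y0 : bool -> R) : 0 < K ->
  (forall b, rmeas (c b)) -> (forall b t, `|c b t| <= K) ->
  (forall b t, t < A -> c b t = 0) ->
  exists y : bool -> R -> R,
    (forall b, y b A = y0 b) /\
    (forall b, AC_with_deriv (y b) (fun t => c b t * y (~~ b) t)).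
Proof.
move=> K0 mc cK c0.
have lc b : locint (c b) by apply: locint_locbnd => // s t; exists K.
pose T (y : bool -> R -> R) b x := y0 b + prim A (fun t => c b t * y (~~ b) t) x.
pose Y := fix Y n : bool -> R -> R := if n is n.+1 then T (Y n) else fun b _ => y0 b.
have YS n b x : Y n.+1 b x = y0 b + prim A (fun t => c b t * Y n (~~ b) t) x by [].
have cY n : forall b, continuous (Y n b).
  elim: n => [|n IH] b; first by move=> x; exact: cvg_cst.
  have l : locint (fun t => c b t * Y n (~~ b) t) by apply: locintMc.
  exact: AC_continuous (ACD (AC_cst (y0 b)) (prim_AC A l)).
have lY n b : locint (fun t => c b t * Y n (~~ b) t) by apply: locintMc.
have f0 (y : R -> R) b t : t < A -> c b t * y t = 0 by move=> /c0 ->; rewrite mul0r.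
pose M := `|y0 true| + `|y0 false|.
have yM b : `|y0 b| <= M by case: b; rewrite /M ?lerDl ?lerDr.
have M0 : 0 <= M by rewrite addr_ge0.
have rhs0 n x : 0 <= M / 2 ^+ n * wt A K x.
  by rewrite mulr_ge0 ?divr_ge0 ?exprn_ge0// ltW// wt_gt0.
have dY n : forall b x, `|Y n.+1 b x - Y n b x| <= M / 2 ^+ n * wt A K x.
  elim: n => [|n IH] b x.
    have [Ax|xA] := leP A x; last first.
      rewrite YS prim_lt//; [by rewrite addr0 subrr normr0|by move=> t; exact: f0].
    rewrite YS/= /prim Ax addrAC subrr add0r expr0 divr1.
    apply: (@le_trans _ _ (M / 2 * wt A K x)); last first.
      by rewrite ler_wpM2r ?(ltW (wt_gt0 _ _ _))//; lra.
    apply: le_norm_Int_wt => //; first exact: (lY 0%N).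
    move=> t /andP[At tx]; rewrite normrM mulrCA; apply: ler_pM => //.
    rewrite -[leLHS]mulr1; apply: ler_pM => //; exact: wt_ge1 (ltW K0) At.
  have [Ax|xA] := leP A x; last first.
    by rewrite !YS !prim_lt// => [|t|t]; [rewrite subrr normr0|exact: f0|exact: f0].
  rewrite (YS n.+1) (YS n) /prim Ax opprD addrACA subrr add0r -IntB//.
  have -> : M / 2 ^+ n.+1 = M / 2 ^+ n / 2 by rewrite exprS; field; rewrite expf_neq0.
  apply: le_norm_Int_wt => //; first by rewrite divr_ge0 ?exprn_ge0.
    exact: locintB.
  by move=> t _; rewrite -mulrBr normrM mulrCA; apply: ler_pM.
have /choice[y yP] : forall bx : bool * R, exists l, forall n, `|l - Y n bx.1 bx.2| <=
    2 * (M * wt A K bx.2) / 2 ^+ n.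
  move=> [b x]; apply: geometric_limit => n; apply: le_trans (dY n b x) _.
  by rewrite mulrAC.
have {}yP n b x : `|y (b, x) - Y n b x| <= 2 * M / 2 ^+ n * wt A K x.
  apply: le_trans (yP (b, x) n) _ => /=; rewrite le_eqVlt; apply/orP; left; apply/eqP;
      ring.
have my b : rmeas (fun x => y (b, x)).
  apply: (measurable_fun_cvg (h := fun n => Y n b)).
    by move=> n; exact: continuous_rmeas.
  move=> x _; apply/cvgrPdist_le => e e0.
  have cv : 2 * M * wt A K x * 2^-1 ^+ n @[n --> \oo] --> 2 * M * wt A K x * 0.
    by apply: cvgM; [exact: cvg_cst|apply: cvg_expr; rewrite ger0_norm; lra].
  rewrite mulr0 in cv; move/cvgrPdist_lt : cv => /(_ _ e0); apply: filterS => n.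
  rewrite sub0r normrN exprVn => /ltW eN.
  apply: le_trans (yP n b x) _; apply: le_trans eN; apply: le_trans (ler_norm _).
  by rewrite mulrAC.
have by_ b : locbnd (fun x => y (b, x)).
  move=> s t; exists (M + 2 * M * wt A K t) => x /andP[_ xt].
  have -> : y (b, x) = y0 b + (y (b, x) - Y 0%N b x) by rewrite /=; ring.
  apply: le_trans (ler_normD _ _) _; apply: lerD => //.
  apply: le_trans (yP 0%N b x) _; rewrite expr0 divr1 ler_wpM2l ?mulr_ge0//.
  by apply: le_wt => //; exact: ltW.
have ly b : locint (fun t => c b t * y (~~ b, t)) by apply: locintM.
(* Both sides are compared with [Y n.+1]: the left one by the rate of convergence, the right one by
   the contraction applied to [y - Y n]. *)
have yE b x : y (b, x) = y0 b + prim A (fun t => c b t * y (~~ b, t)) x.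
  apply/eqP; rewrite -subr_eq0; apply/eqP.
  apply: (@geometric_eq0 _ _ (2 * M * wt A K x)) => n.
  rewrite (_ : _ - _ = (y (b, x) - Y n.+1 b x) + (Y n.+1 b x - (y0 b + prim A (fun t =>
      c b t * y (~~ b, t)) x))); last by ring.
  apply: le_trans (ler_normD _ _) _.
  have e1 : 2 * M * wt A K x / 2 ^+ n = 2 * M / 2 ^+ n.+1 * wt A K x + 2 * M / 2 ^+ n /
      2 * wt A K x.
    by rewrite exprS; field; rewrite expf_neq0.
  rewrite e1; apply: lerD; first exact: yP.
  have w0 := ltW (wt_gt0 A K x).
  have [Ax|xA] := leP A x; last first.
    rewrite YS !prim_lt//.
    - by rewrite subrr normr0 !mulr_ge0 ?invr_ge0 ?exprn_ge0.
    - by move=> t /c0 ->; rewrite mul0r.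
    - by move=> t /c0 ->; rewrite mul0r.
  rewrite YS /prim Ax opprD addrACA subrr add0r -IntB//.
  apply: le_norm_Int_wt => //; first by rewrite divr_ge0 ?exprn_ge0// mulr_ge0.
    exact: locintB.
  by move=> t _; rewrite -mulrBr normrM mulrCA; apply: ler_pM => //; rewrite distrC.
exists (fun b x => y (b, x)); split=> b.
  by rewrite yE /prim lexx Intxx addr0.
apply: (eq_AC _ _ (ACD (AC_cst (y0 b)) (prim_AC A (ly b)))) => x; first by rewrite -yE.
by rewrite add0r.
Qed.

End linear_system.

(** * Dilations, and the first-order expansion in the dilation factor *)

Section dilation.
Context {R : realType}.
Implicit Types (f g : R -> R) (a x y : R).

(** Lebesgue measure is [a] times its image under [t |-> a * t]: the two agree on half-open
    intervals, and uniqueness of the extension does the rest. *)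
Lemma ge0_integral_dilation f a x y : 0 < a -> rmeas f -> (forall t, 0 <= f t) ->
  (\int[leb R]_(t in `[(a * x)%R, (a * y)%R]) (f t)%:E =
   a%:E * \int[leb R]_(t in `[x, y]) (f (a * t)%R)%:E)%E.
Proof.
move=> a0 mf f0.
pose phi : measurableTypeR R -> measurableTypeR R := fun t => a * t.
have mphi : measurable_fun setT phi.
  apply: (@continuous_measurable_fun R (fun t : R => a * t)) => t.
  by apply: cvgM; [exact: cvg_cst|exact: cvg_id].
pose a' : {nonneg R} := NngNum (ltW a0).
have [pm pmE] : exists pm : {measure set (measurableTypeR R) -> \bar R},
    (pm : set _ -> \bar R) = pushforward (leb R) phi.
  by unshelve eexists; [refine (pushforward (leb R) phi : measure _ R)|].
pose nu : {measure set (measurableTypeR R) -> \bar R} := mscale a' pm.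
have nuE X : measurable X -> leb R X = nu X.
  apply: lebesgue_measure_unique => _ [[p q] _ <-] /=.
  rewrite /nu /mscale/= pmE /pushforward.
  have -> : phi @^-1` `]p, q] = `]p / a, q / a]%classic.
    apply/seteqP; split => t /=; rewrite !in_itv/= /phi.
      by rewrite ltr_pdivrMr// ler_pdivlMr// mulrC.
    by rewrite ltr_pdivrMr// ler_pdivlMr// mulrC.
  rewrite !lebesgue_measure_itv/= !lte_fin ltr_pM2r ?invr_gt0//.
  case: ifP => _; last by rewrite mule0.
  by rewrite -EFinM; congr (_%:E); field; rewrite gt_eqF.
rewrite (eq_measure_integral nu); last by move=> X mX _; exact: nuE.
have mf' D : measurable_fun D (EFin \o f).
  by apply/measurable_EFinP; exact: measurable_funTS.
have -> : (\int[nu]_(t in `[(a * x)%R, (a * y)%R]) (f t)%:E =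
    a%:E * \int[pm]_(t in `[(a * x)%R, (a * y)%R]) (f t)%:E)%E.
  apply: (ge0_integral_mscale pm _ a'); [exact: measurable_itv|exact: mf'|].
  by move=> t _; rewrite lee_fin.
rewrite pmE ge0_integral_pushforward//; [|exact: mf'|by move=> t _; rewrite lee_fin].
congr (_ * _)%E; congr (integral _ _ _).
apply/seteqP; split => t /=; rewrite !in_itv/= /phi !ler_pM2l//.
Qed.

Lemma locint_dilation f a : 0 < a -> rmeas f -> locint f -> locint (fun t => f (a * t)).
Proof.
move=> a0 mf lf x y.
have ma : rmeas (fun t : R => f (a * t)).
  apply: (measurableT_comp mf); apply: (@continuous_measurable_fun R (fun t : R => a *
      t)) => t.
  by apply: cvgM; [exact: cvg_cst|exact: cvg_id].
apply/integrableP; split.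
  by apply/measurable_EFinP; exact: measurable_funTS.
have /integrableP[_ fin] := lf (a * x) (a * y).
have mnf : rmeas (fun t => `|f t|) by exact: measurableT_comp.
have H := @ge0_integral_dilation (fun t => `|f t|) a x y a0 mnf (fun _ => normr_ge0 _).
move: fin; rewrite [X in (X < _)%E -> _]H => fin.
have I0 : (0 <= \int[leb R]_(t in `[x, y]) `|f (a * t)%R|%:E)%E.
  by apply: integral_ge0 => t _; rewrite lee_fin.
move: fin I0; set J := (\int[_]_(t in _) _)%E => fin J0.
change (J < +oo)%E; case: J fin J0 => [j _ _| |]//; first by rewrite ltry.
by rewrite mulr_infty gtr0_sg// mul1e.
Qed.

Lemma Int_dilation f a x y : 0 < a -> rmeas f -> locint f ->
  Int f (a * x) (a * y) = a * Int (fun t => f (a * t)) x y.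
Proof.
move=> a0 mf lf.
pose p t : R := Num.max (f t) 0; pose n t : R := Num.max (- f t) 0.
have fpn t : f t = p t - n t by rewrite /p /n; case: (leP (f t) 0); case: (leP (- f t)
    0); lra.
have mp : rmeas p by apply: measurable_maxr => //; exact: measurable_cst.
have mn : rmeas n.
  by apply: measurable_maxr; [exact: measurableT_comp|exact: measurable_cst].
have bnd (g : R -> R) : rmeas g -> (forall t, `|g t| <= `|f t|) -> locint g.
  move=> mg gf s t; apply: le_integrable (lf s t) => //.
    by apply/measurable_EFinP; exact: measurable_funTS.
  by move=> v _; rewrite lee_fin.
have lp : locint p by apply: bnd => // t; rewrite /p; case: (leP (f t) 0) => _; rewrite
    ?normr0 ?lexx ?normr_ge0.
have ln : locint n by apply: bnd => // t; rewrite /n; case: (leP (- f t) 0) => _;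
    rewrite ?normr0 ?normrN ?lexx ?normr_ge0.
have H g : (forall t, 0 <= g t) -> rmeas g -> locint g -> Int g (a * x) (a * y) = a *
    Int (fun t => g (a * t)) x y.
  move=> g0 mg lg; rewrite /Int /Rintegral ge0_integral_dilation// fineM//.
  exact: integrable_fin_num (locint_dilation a0 mg lg x y).
have p0 t : 0 <= p t by rewrite /p le_max lexx orbT.
have n0 t : 0 <= n t by rewrite /n le_max lexx orbT.
rewrite (@eq_Int _ f (fun t => p t - n t))// IntB// !H//.
rewrite -mulrBr -IntB; [|exact: locint_dilation|exact: locint_dilation].
by congr (_ * _); apply: eq_Int.
Qed.

Lemma AC_dilation f df a : 0 < a -> rmeas df -> AC_with_deriv f df ->
  AC_with_deriv (fun x => f (a * x)) (fun x => a * df (a * x)).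
Proof.
move=> a0 mdf ff; have ldf := AC_locint ff.
have l := locint_dilation a0 mdf ldf.
apply: AC_intro; first exact: locintZ.
by move=> x y xy; rewrite IntZ// -Int_dilation// (AC_Int ff)// ler_pM2l.
Qed.

(* AM-GM: [|df| <= (eta + df ^ 2 / eta) / 2]; the first part is small on short
   intervals, the second for large [eta]. *)
Lemma W21_uniformly_continuous f df : AC_with_deriv f df -> L2 df ->
  forall e : R, 0 < e -> exists2 d : R, 0 < d & forall x y, `|x - y| <= d -> `|f x - f
      y| <= e.
Proof.
move=> ff [mdf idf] e e0.
have ldf2 : locint (fun t => df t ^+ 2) by move=> x y; apply: integrableS idf.
pose N := \int[leb R]_x (df x ^+ 2).
have N0 : 0 <= N by apply: Rintegral_ge0 => x _; exact: sqr_ge0.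
have leN x y : Int (fun t => df t ^+ 2) x y <= N.
  rewrite /Int Rintegral_mkcond; apply: le_Rintegral => //.
    by rewrite -restrict_EFin; apply/integrable_restrict => //=; rewrite setTI; exact:
        ldf2.
  by move=> t _; rewrite patchE; case: ifP => // _; exact: sqr_ge0.
(* With this value the quadratic part contributes at most [N / (2 * eta) <= e / 2], and on intervals
   of length at most [e / eta] the constant part at most [e / 2]. The [+ 1] keeps [eta] positive
   when [N = 0]. *)
pose eta := (N + 1) / e.
have eta0 : 0 < eta by rewrite divr_gt0// ltr_wpDl.
exists (e / eta); first by rewrite divr_gt0.
suff H x y : x <= y -> y - x <= e / eta -> `|f y - f x| <= e.
  move=> x y; have [xy|/ltW yx] := leP x y; first by rewrite distrC [leLHS]ger0_norm
      ?subr_ge0// => /(H _ _ xy); rewrite distrC.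
  by rewrite ger0_norm ?subr_ge0//; exact: H.
move=> xy d; rewrite (AC_Int ff xy).
apply: (@le_trans _ _ (Int (fun t => eta / 2 + (2 * eta)^-1 * df t ^+ 2) x y)).
  apply: le_norm_Int; [exact: AC_locint ff|by apply: locintD; [exact: locint_cst|exact:
      locintZ]|].
  move=> t _; rewrite -subr_ge0 -real_normK ?num_real//.
  have -> : eta / 2 + (2 * eta)^-1 * `|df t| ^+ 2 - `|df t| = (2 * eta)^-1 * (eta -
      `|df t|) ^+ 2.
    by field; rewrite gt_eqF.
  by rewrite mulr_ge0 ?sqr_ge0// invr_ge0 mulr_ge0// ltW.
rewrite IntD; [|exact: locint_cst|exact: locintZ].
rewrite Int_cst// IntZ//.
have h1 : eta / 2 * (y - x) <= e / 2.
  apply: le_trans (ler_wpM2l _ d) _; first by rewrite divr_ge0 ?ltW.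
  by rewrite le_eqVlt; apply/orP; left; apply/eqP; field; rewrite gt_eqF.
have h2 : (2 * eta)^-1 * Int (fun t => df t ^+ 2) x y <= e / 2.
  apply: (@le_trans _ _ ((2 * eta)^-1 * (N + 1))).
    apply: ler_wpM2l; first by rewrite invr_ge0 mulr_ge0// ltW.
    by apply: le_trans (leN x y) _; rewrite lerDl.
  rewrite /eta le_eqVlt; apply/orP; left; apply/eqP; field.
  by rewrite !gt_eqF// ltr_wpDl.
lra.
Qed.

(** The remainder is the integral of [dg t - dg x]. It is applied to the primitive of [V], where [w]
    comes from the uniform continuity of [V]. *)
Lemma AC_taylor1 g dg x y w : AC_with_deriv g dg -> 
  (forall t, `|t - x| <= `|y - x| -> `|dg t - dg x| <= w) ->
  `|g y - g x - (y - x) * dg x| <= w * `|y - x|.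
Proof.
move=> gg H; have lg := AC_locint gg.
have l : locint (fun t => dg t - dg x) by apply: locintB => //; exact: locint_cst.
have [xy|/ltW yx] := leP x y.
  rewrite [in leRHS]ger0_norm ?subr_ge0//.
  have -> : g y - g x - (y - x) * dg x = Int (fun t => dg t - dg x) x y.
    by rewrite IntB//; [rewrite (AC_Int gg xy) Int_cst// [dg x * _]mulrC|exact:
        locint_cst].
  apply: le_norm_Int_cst => // t /andP[xt ty]; apply: H.
  by rewrite !ger0_norm ?subr_ge0//; lra.
rewrite [in leRHS]ler0_norm ?subr_le0//.
have -> : g y - g x - (y - x) * dg x = - Int (fun t => dg t - dg x) y x.
  by rewrite IntB//; [rewrite -(AC_Int gg yx) Int_cst//; ring|exact: locint_cst].
rewrite normrN opprB; apply: le_norm_Int_cst => // t /andP[yt tx]; apply: H.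
by rewrite !ler0_norm ?subr_le0//; lra.
Qed.

Lemma AC_id : AC_with_deriv (fun x : R => x) (fun=> 1).
Proof.
by apply: AC_intro; [exact: locint_cst|move=> x y xy; rewrite Int_cst// mul1r].
Qed.

(** The bracket multiplying [s - a] is the formal derivative of [s * Int (V (s x) u ^ 2)] at
    [s = a]. The support condition is stated with [a / 2] so that [V (s x)] vanishes for [|x| >= r]
    for every [s >= a / 2] at once. *)
Lemma dilated_potential_expansion (V dV u du : R -> R) (a r : R) :
  0 < a -> 0 < r -> AC_with_deriv V dV -> L2 dV ->
  (forall x, a / 2 * r <= `|x| -> V x = 0) ->
  AC_with_deriv u du -> continuous du ->
  forall e : R, 0 < e -> exists2 d : R, 0 < d & forall s, `|s - a| <= d ->
    `|s * Int (fun x => V (s * x) * u x ^+ 2) (- r) r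
      - a * Int (fun x => V (a * x) * u x ^+ 2) (- r) r
      - (s - a) * (Int (fun x => V (a * x) * u x ^+ 2) (- r) r
                   + a * Int (fun x => x * dV (a * x) * u x ^+ 2) (- r) r)|
    <= e * `|s - a|.
Proof.
move=> a0 r0 VV L2dV V0 uu cdu e e0.
have [mdV _] := L2dV.
have cV := AC_continuous VV; have cu := AC_continuous uu.
have lV := continuous_locint cV.
(* Starting at the left edge of the support makes [P] zero to the left of it and constant to the
   right, so that the boundary term below does not depend on [s]. *)
pose P := prim (- (a / 2 * r)) V.
have PP : AC_with_deriv P V by exact: prim_AC.
pose w x := 2 * (u x * du x).
have cw : continuous w.
  by move=> x; apply: cvgM; [exact: cvg_cst|apply: cvgM; [exact: cu|exact: cdu]].
have ww : AC_with_deriv (fun x => u x ^+ 2) w.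
  apply: eq_AC (ACM uu uu (continuous_locbnd cdu)) => x; first by rewrite expr2.
  by rewrite /w; ring.
have cu2 := AC_continuous ww.
have rr : - r <= r by lra.
have cdil s (g : R -> R) : continuous g -> continuous (fun x => g (s * x)).
  move=> cg x; apply: (@continuous_comp _ _ _ (fun x => s * x) g); last exact: cg.
  by apply: cvgM; [exact: cvg_cst|exact: cvg_id].
have Ps s : 0 < s -> AC_with_deriv (fun x => P (s * x)) (fun x => s * V (s * x)).
  by move=> s0; apply: AC_dilation => //; exact: continuous_rmeas.
have ar : 0 < a / 2 * r by rewrite mulr_gt0// divr_gt0.
have Pl x : x <= - (a / 2 * r) -> P x = 0.
  rewrite le_eqVlt => /predU1P[->|xl]; first by rewrite /P /prim lexx Intxx.
  apply: prim_lt => // t tl; apply: V0; rewrite ler0_norm; lra.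
have Pr x : a / 2 * r <= x -> P x = P (a / 2 * r).
  move=> xr; apply/eqP; rewrite -subr_eq0 (AC_Int PP xr) (@eq_Int _ _ (fun=> 0)).
    by rewrite Int_cst// mul0r.
  by move=> t /andP[ht _]; apply: V0; rewrite ger0_norm; lra.
have lVu s : locint (fun x => V (s * x) * u x ^+ 2).
  apply: continuous_locint => x.
  by apply: cvgM; [exact: (cdil s _ cV)|exact: cu2].
have lPw s : locint (fun x => P (s * x) * w x).
  apply: continuous_locint => x.
  by apply: cvgM; [exact: (cdil s _ (AC_continuous PP))|exact: cw].
have parts s : a / 2 <= s -> s * Int (fun x => V (s * x) * u x ^+ 2) (- r) r =
    P (a / 2 * r) * u r ^+ 2 - Int (fun x => P (s * x) * w x) (- r) r.
  move=> s2; have s0 : 0 < s by apply: lt_le_trans s2; rewrite divr_gt0.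
  have := AC_Int (ACM (Ps s s0) ww (continuous_locbnd cw)) rr.
  rewrite IntD//; last by apply: continuous_locint => x; apply: cvgM; [apply: cvgM;
      [exact: cvg_cst|exact: (cdil s _ cV)]|exact: cu2].
  rewrite (Pl (s * - r)); last by rewrite mulrN lerN2 ler_wpM2r// ltW.
  rewrite (Pr (s * r)); last by rewrite ler_wpM2r// ltW.
  rewrite mul0r subr0 => ->; rewrite -IntZ// addrK.
  by apply: eq_Int => x _; ring.
pose I := Int (fun x => x * dV (a * x) * u x ^+ 2) (- r) r.
have ldVa : locint (fun x => dV (a * x)) by apply: locint_dilation => //; exact:
    AC_locint VV.
have lxdV : locint (fun x => x * dV (a * x) * u x ^+ 2).
  have : locint (fun x => dV (a * x) * (x * u x ^+ 2)).
    by apply: locintMc => // x; apply: cvgM; [exact: cvg_id|exact: cu2].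
  by congr locint; apply/funext => x; ring.
have lxVw : locint (fun x => x * V (a * x) * w x).
  apply: continuous_locint => x.
  by apply: cvgM; [apply: cvgM; [exact: cvg_id|exact: (cdil a _ cV)]|exact: cw].
(* The derivative in [s] of the remaining integral of [P (s x) w] is that of [x V (s x) w]; at
   [s = a] a second integration by parts moves the derivative from [u ^ 2] onto [x V (a x)]. *)
have byparts : Int (fun x => x * V (a * x) * w x) (- r) r =
    - (Int (fun x => V (a * x) * u x ^+ 2) (- r) r + a * I).
  have xV : AC_with_deriv (fun x => V (a * x) * x) (fun x => a * dV (a * x) * x + V (a
      * x) * 1).
    by apply: ACM (AC_dilation a0 mdV VV) AC_id _ => x y; exists 1 => t _; rewrite normr1.
  have := AC_Int (ACM xV ww (continuous_locbnd cw)) rr.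
  have ar2 : a / 2 * r <= a * r by rewrite ler_wpM2r; lra.
  have ar0 : 0 <= a * r by rewrite mulr_ge0// ltW.
  rewrite (V0 (a * r)); last by rewrite ger0_norm.
  rewrite (V0 (a * - r)); last by rewrite mulrN normrN ger0_norm.
  rewrite !mul0r subrr (@eq_Int _ _ (fun x => (a * (x * dV (a * x) * u x ^+ 2) + V (a *
      x) * u x ^+ 2) + x * V (a * x) * w x)); last by move=> x _; ring.
  rewrite !IntD//; [|exact: locintZ|by apply: locintD => //; exact: locintZ].
  by rewrite IntZ// -/I; lra.
have [M wM] := continuous_locbnd cw (- r) r.
have M0 : 0 <= M by apply: le_trans (normr_ge0 _) (wM 0 _); apply/andP; split; lra.
(* In the Taylor remainder [|s x - a x|] costs one factor [r], [w] costs [M + 1], and integrating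
   over [-r, r] costs [2 * r]. *)
pose e' := e / (2 * r * r * (M + 1)).
have e'0 : 0 < e' by rewrite divr_gt0// !mulr_gt0//; lra.
have [d d0 Vd] := W21_uniformly_continuous VV L2dV e'0.
(* The first bound keeps [s x] within [d] of [a x] for [|x| <= r], the second ensures
   [s >= a / 2]. *)
exists (Num.min (d / r) (a / 2)); first by rewrite lt_min !divr_gt0.
move=> s; rewrite le_min => /andP[sd sa2].
have s2 : a / 2 <= s by move: sa2; rewrite ler_norml => /andP[]; lra.
rewrite (parts s)// (parts a)//; last by lra.
have -> : forall A B, P (a / 2 * r) * u r ^+ 2 - A - (P (a / 2 * r) * u r ^+ 2 - B) = B
    - A by move=> *; ring.
rewrite -/I.
rewrite (_ : _ - _ - _ = Int (fun x => P (a * x) * w x - P (s * x) * w x + (s - a) * (x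
    * V (a * x) * w x)) (- r) r); last first.
  rewrite (IntD _ _ (locintB (lPw a) (lPw s)) (locintZ (s - a) lxVw)).
  by rewrite (IntB _ _ (lPw a) (lPw s)) (IntZ _ _ _ lxVw) byparts mulrN.
have -> : e * `|s - a| = e / (2 * r) * `|s - a| * (r - - r) by field; rewrite gt_eqF.
apply: le_norm_Int_cst => //; first by apply: locintD; [exact: locintB|exact: locintZ].
move=> x xr.
have -> : P (a * x) * w x - P (s * x) * w x + (s - a) * (x * V (a * x) * w x)
  = - ((P (s * x) - P (a * x) - (s * x - a * x) * V (a * x)) * w x) by ring.
have xr' : `|x| <= r by rewrite ler_norml.
rewrite normrN normrM.
have T : `|P (s * x) - P (a * x) - (s * x - a * x) * V (a * x)| <= e' * `|s * x - a * x|.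
  apply: AC_taylor1 => // t ht; apply: Vd; apply: le_trans ht _.
  rewrite -mulrBl normrM; apply: (@le_trans _ _ (d / r * r)); last by rewrite divfK//
      gt_eqF.
  exact: ler_pM.
apply: (@le_trans _ _ (e' * (`|s - a| * r) * (M + 1))).
  apply: ler_pM => //; last by have := wM _ xr; lra.
  by apply: le_trans T _; rewrite -mulrBl normrM ler_wpM2l ?(ltW e'0)// ler_wpM2l.
rewrite le_eqVlt; apply/orP; left; apply/eqP; rewrite /e'; field.
by rewrite !gt_eqF//; lra.
Qed.

End dilation.

(** * The initial value problem and the shooting function *)

Section shooting.
Context {R : realType}.
Implicit Types (A B K G H r k x t : R) (U Q p q u du : R -> R).

(** The initial values and the source [h] together play the role of the defect in [gronwall]. It
    serves three times: for the size of the solutions, for their distance to [u], and for their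
    dependence on [k]. *)
Lemma linear_system_bound A B K G H (c h z : bool -> R -> R) : 0 < K -> A <= B ->
  (forall b, rmeas (c b)) -> (forall b t, `|c b t| <= K) ->
  (forall b, locint (h b)) -> (forall b t, A <= t <= B -> `|h b t| <= H) ->
  (forall b, continuous (z b)) -> (forall b, `|z b A| <= G) ->
  (forall b x, A <= x <= B -> z b x - z b A = Int (fun t => c b t * z (~~ b) t + h b t)
      A x) ->
  forall b x, A <= x <= B -> `|z b x| <= 2 * (G + H * (B - A)) * wt A K B.
Proof.
move=> K0 AB mc cK lh hH cz zG zE b x xAB.
have H0 : 0 <= H by apply: le_trans (normr_ge0 _) (hH true A _); rewrite lexx.
have G0 : 0 <= G by apply: le_trans (normr_ge0 _) (zG true).
have GH0 : 0 <= G + H * (B - A) by rewrite addr_ge0// mulr_ge0// subr_ge0.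
have lc d : locint (c d) by apply: locint_locbnd => // s t; exists K.
have lcz d : locint (fun t => c d t * z (~~ d) t) by apply: locintMc.
apply: (@le_trans _ _ (2 * (G + H * (B - A)) * wt A K x)); last first.
  have /andP[_ xB] := xAB.
  by apply: ler_wpM2l; [rewrite mulr_ge0|apply: le_wt => //; exact: ltW].
apply: (@gronwall _ A B K _ c z) => // d y yAB; have /andP[Ay yB] := yAB.
have -> : z d y - Int (fun t => c d t * z (~~ d) t) A y = z d A + Int (h d) A y.
  by move: (zE d y yAB); rewrite IntD//; lra.
apply: le_trans (ler_normD _ _) _; apply: lerD => //.
apply: (@le_trans _ _ (H * (y - A))).
  apply: le_norm_Int_cst => // t /andP[At ty]; apply: hH.
  by rewrite At (le_trans ty yB).
by apply: ler_wpM2l => //; lra.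
Qed.

(* The cut-off makes the solutions constant to the left of [A], so that they are
   absolutely continuous on the whole line. *)
Definition chi A t : R := \1_(`[A, +oo[%classic) t.

Lemma chi1 A t : A <= t -> chi A t = 1.
Proof. by move=> At; rewrite /chi indicE mem_set//= in_itv/= At. Qed.

Lemma chi0 A t : t < A -> chi A t = 0.
Proof.
move=> tA; rewrite /chi indicE memNset//= in_itv/= andbT; apply/negP.
by rewrite -ltNge.
Qed.

Lemma chi_le1 A t : `|chi A t| <= 1.
Proof.
have [At|tA] := leP A t; first by rewrite chi1// normr1.
by rewrite chi0// normr0.
Qed.

Lemma rmeas_chi A : rmeas (chi A).
Proof. by apply: measurable_indic; exact: measurable_itv. Qed.

(** Index [true] is the solution and [false] its derivative, so that p'' = Q p becomes an
    off-diagonal system to the right of [A]. *)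
Lemma initial_value_solution A M Q (p0 q0 : R) : rmeas Q -> (forall t, `|Q t| <= M) ->
  exists y : bool -> R -> R, [/\ y true A = p0, y false A = q0,
    AC_with_deriv (y true) (fun t => chi A t * y false t) &
    AC_with_deriv (y false) (fun t => chi A t * Q t * y true t)].
Proof.
move=> mQ QM.
have M0 : 0 <= M by apply: le_trans (normr_ge0 _) (QM 0).
pose c b t : R := if b then chi A t else chi A t * Q t.
have [|||| y [y0 yE]] := @linear_system_solution _ A (M + 1) c (fun b => if b then p0
    else q0).
- by lra.
- by case=> /=; [exact: rmeas_chi|apply: measurable_funM => //; exact: rmeas_chi].
- case=> t /=; first by apply: le_trans (chi_le1 A t) _; lra.
  rewrite normrM -[leRHS]mul1r; apply: ler_pM => //; first exact: chi_le1.
  by apply: le_trans (QM t) _; lra.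
- by case=> t tA /=; rewrite chi0// mul0r.
by exists y; split; [exact: (y0 true)|exact: (y0 false)|exact: (yE true)|exact: (yE
    false)].
Qed.

(** The products [q * du] cancel in the derivative of the Wronskian, which leaves only the
    difference of the potentials. *)
Lemma wronskian A B U Q p q u du : A <= B ->
  AC_with_deriv u du -> AC_with_deriv du (fun t => U t * u t) ->
  AC_with_deriv p (fun t => chi A t * q t) ->
  AC_with_deriv q (fun t => chi A t * Q t * p t) ->
  (q B * u B - du B * p B) - (q A * u A - du A * p A) =
  Int (fun t => (Q t - U t) * p t * u t) A B.
Proof.
move=> AB uu dd pp qq.
have cdu := AC_continuous dd; have cq := AC_continuous qq.
have bq : locbnd (fun t => chi A t * q t).
  move=> x y; have [M qM] := continuous_locbnd cq x y; exists M => t xty.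
  apply: le_trans (qM t xty); rewrite normrM -[leRHS]mul1r.
  by apply: ler_pM => //; exact: chi_le1.
have := AC_Int (ACB (ACM qq uu (continuous_locbnd cdu)) (ACM dd pp bq)) AB.
move=> ->; apply: eq_Int => t /andP[At _].
by rewrite chi1//; ring.
Qed.

(** The Wronskian of [u] with the solution of data (0, 1) at [A] is constant and equals 1 at [A]; it
    would be 0 at [B] if [u] and [du] both vanished there. *)
Lemma half_bound_state_neq0 A B M U u du : A <= B -> rmeas U -> (forall t, `|U t| <= M) ->
  AC_with_deriv u du -> AC_with_deriv du (fun t => U t * u t) ->
  u A = 1 -> du A = 0 -> du B = 0 -> u B != 0.
Proof.
move=> AB mU UM uu dd uA duA duB.
have [y [y1 y2 pp qq]] := initial_value_solution A 0 1 mU UM.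
have := wronskian AB uu dd pp qq.
rewrite (@eq_Int _ _ (fun=> 0)); last by move=> t _; rewrite subrr !mul0r.
rewrite Int_cst// mul0r y1 y2 uA duA duB => h.
by apply/eqP => uB; move: h; rewrite uB; lra.
Qed.

(** [C] is quantified before [V] and [eps], hence uniform over all dilates of one potential. The
    Wronskian identity gives the remainder exactly: [k * u r * (p r - u r)] plus the integral of
    [(Q - U) p u - eps V u ^ 2]. Since [p - u = O(k + eps)] and [Q - U = eps V + k ^ 2], both parts
    are quadratic. *)
Lemma shooting_function U u du r MU MV Mu : 0 < r -> rmeas U -> (forall t, `|U t| <=
    MU) ->
  AC_with_deriv u du -> AC_with_deriv du (fun t => U t * u t) ->
  u (- r) = 1 -> du (- r) = 0 -> du r = 0 -> (forall t, `|u t| <= Mu) -> 0 <= MV ->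
  exists2 C, 0 <= C & forall (V : R -> R) (eps : R), rmeas V -> (forall t, `|V t| <=
      MV) ->
    0 <= eps <= 1 ->
    exists y : R -> bool -> R -> R,
      (forall k, 0 <= k <= 1 -> [/\ y k true (- r) = 1, y k false (- r) = k,
        AC_with_deriv (y k true) (fun t => chi (- r) t * y k false t),
        AC_with_deriv (y k false) (fun t => chi (- r) t * (U t + eps * V t + k ^+ 2) *
            y k true t) &
        `|u r * (y k false r + k * y k true r) - k * (1 + u r ^+ 2)
          - eps * Int (fun t => V t * u t ^+ 2) (- r) r| <= C * (k + eps) ^+ 2]) /\
      (forall k l : R, 0 <= k <= 1 -> 0 <= l <= 1 ->
        `|(y k false r + k * y k true r) - (y l false r + l * y l true r)| <= C * `|k -
            l|).
Proof.
move=> r0 mU UM uu dd uA duA duB uM MV0.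
have MU0 : 0 <= MU by apply: le_trans (normr_ge0 _) (UM 0).
have Mu0 : 0 <= Mu by apply: le_trans (normr_ge0 _) (uM 0).
have rr : - r <= r by lra.
have cu := AC_continuous uu; have cdu := AC_continuous dd.
have [K KE] : exists K, K = MU + MV + 2 by eexists.
have K0 : 0 < K by rewrite KE; lra.
have [W WE] : exists W, W = wt (- r) K r by eexists.
have W1 : 1 <= W by rewrite WE; apply: wt_ge1 => //; exact: ltW.
have W0 : 0 <= W by lra.
(* All solutions are bounded by [4 * W]. [C1] controls [p - u] relative to [k + eps], [L] is the
   Lipschitz constant in [k] of the values at [r], and [D] collects the two parts of the Wronskian
   remainder. *)
have [C1 C1E] : exists C, C = 2 * (1 + (MV + 1) * (4 * W) * (2 * r)) * W by eexists.
have [L LE] : exists L, L = 2 * (1 + 2 * (4 * W) * (2 * r)) * W by eexists.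
have C10 : 0 <= C1 by rewrite C1E !(mulr_ge0, addr_ge0)//; lra.
have L0 : 0 <= L by rewrite LE !(mulr_ge0, addr_ge0)//; lra.
have [D DE] : exists D, D = `|u r| * C1 + (MV * C1 * Mu + 4 * W * Mu) * (2 * r) by
    eexists.
have D0 : 0 <= D by rewrite DE !(mulr_ge0, addr_ge0)//; lra.
(* One constant for both conclusions: [D] for the expansion; for the Lipschitz bound of p' r + k p
   r, one [L] for each of p' and p, and [4 * W] for the variation of the factor [k]. *)
exists (D + L + L + 4 * W); first by lra.
move=> V eps mV VM /andP[e0 e1].
pose Q k t := U t + eps * V t + k ^+ 2.
have mQ k : rmeas (Q k).
  apply: measurable_funD; last exact: measurable_cst.
  by apply: measurable_funD => //; apply: measurable_funM => //; exact: measurable_cst.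
have eV t : `|eps * V t| <= MV.
  by rewrite normrM -[leRHS]mul1r; apply: ler_pM => //; rewrite ger0_norm.
have QM k t : `|k| <= 1 -> `|Q k t| <= K.
  move=> k1; apply: le_trans (ler_normD _ _) _.
  have : `|k ^+ 2| <= 1 by rewrite normrX expr_le1.
  have := ler_normD (U t) (eps * V t); have := UM t; have := eV t.
  rewrite KE; lra.
have QM' k t : `|Q k t| <= K + k ^+ 2.
  apply: le_trans (ler_normD _ _) _; rewrite [X in _ + X]ger0_norm ?sqr_ge0//.
  have := ler_normD (U t) (eps * V t); have := UM t; have := eV t.
  rewrite KE; lra.
have /choice[y yP] := fun k => initial_value_solution (- r) 1 k (mQ k) (QM' k).
exists y.
have cy k b : continuous (y k b).
  have [_ _ pp qq] := yP k.
  by case: b; [exact: AC_continuous pp|exact: AC_continuous qq].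
have lQ k : locint (Q k) by apply: locint_locbnd => // s t; exists (K + k ^+ 2) => v _.
have abs01 k : 0 <= k <= 1 -> `|k| <= 1 by move=> /andP[k0 k1]; rewrite ger0_norm.
have l0 : locint (fun=> 0 : R) by exact: locint_cst.
pose c k b t : R := if b then 1 else Q k t.
have mc k b : rmeas (c k b) by case: b; [exact: measurable_cst|exact: mQ].
have cK k b t : `|k| <= 1 -> `|c k b t| <= K.
  by move=> k1; case: b => /=; [rewrite normr1 KE; lra|exact: QM].
have yW k b x : 0 <= k <= 1 -> - r <= x <= r -> `|y k b x| <= 4 * W.
  move=> k01 xr; have [y1 y2 pp qq] := yP k.
  have := @linear_system_bound (- r) r K 2 0 (c k) (fun _ _ => 0) (y k) K0 rr (mc k)
      (fun b t => cK k b t (abs01 k k01)).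
  move=> bnd; apply: le_trans (bnd _ _ _ _ _ b x xr) _ => //.
  - by move=> *; rewrite normr0.
  - case; rewrite ?y1 ?y2 ?normr1; first by lra.
    by apply: le_trans (abs01 k k01) _; lra.
  - case=> v /andP[rv vr].
      by rewrite (AC_Int pp rv); apply: eq_Int => t /andP[rt _]; rewrite /c chi1//; ring.
    by rewrite (AC_Int qq rv); apply: eq_Int => t /andP[rt _]; rewrite /c chi1//; ring.
  by rewrite -WE le_eqVlt; apply/orP; left; apply/eqP; ring.
(* The difference solves the system of [U] with source [(Q - U) p], where [k ^ 2 <= k] bounds the
   source linearly; the initial values differ by [k], in the derivative only. *)
have yu k b x : 0 <= k <= 1 -> - r <= x <= r ->
    `|y k b x - (if b then u x else du x)| <= C1 * (k + eps).
  move=> k01 xr; have [y1 y2 pp qq] := yP k; have /andP[k0 k1] := k01.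
  pose z b x := y k b x - (if b then u x else du x).
  pose h b t : R := if b then 0 else (Q k t - U t) * y k true t.
  pose c0 b t : R := if b then 1 else U t.
  have mc0 d : rmeas (c0 d) by case: d; [exact: measurable_cst|exact: mU].
  have c0K d t : `|c0 d t| <= K.
    by case: d => /=; [rewrite normr1 KE; lra|apply: le_trans (UM t) _; rewrite KE; lra].
  have lU : locint U by apply: locint_locbnd => // s t; exists MU.
  have := @linear_system_bound (- r) r K k ((eps * MV + k) * (4 * W)) c0 h z K0 rr mc0
      c0K.
  move=> bnd; apply: le_trans (bnd _ _ _ _ _ b x xr) _.
  - by case=> //=; apply: locintMc => //; exact: locintB.
  - case=> t tr /=.
      by rewrite normr0 mulr_ge0 ?addr_ge0 ?mulr_ge0//; lra.
    rewrite normrM; apply: ler_pM => //; last exact: yW.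
    have -> : Q k t - U t = eps * V t + k ^+ 2 by rewrite /Q; ring.
    apply: le_trans (ler_normD _ _) _; apply: lerD.
      by rewrite normrM ger0_norm//; apply: ler_wpM2l.
    by rewrite ger0_norm ?sqr_ge0// expr2 -[leRHS]mulr1; apply: ler_pM.
  - by case=> v; apply: cvgB; [exact: cy|exact: cu|exact: cy|exact: cdu].
  - by case; rewrite /z ?y1 ?y2 ?uA ?duA ?subrr ?normr0// subr0 ger0_norm.
  - case=> v /andP[rv vr]; rewrite /z.
      have := AC_Int (ACB pp uu) rv => ->.
      by apply: eq_Int => t /andP[rt _]; rewrite /c0 chi1//=; ring.
    have := AC_Int (ACB qq dd) rv => ->.
    by apply: eq_Int => t /andP[rt _]; rewrite /c0 /h chi1//=; ring.
  rewrite -subr_ge0 -WE.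
  have -> : C1 * (k + eps) - 2 * (k + (eps * MV + k) * (4 * W) * (r - - r)) * W =
      2 * W * (eps + 4 * W * (2 * r) * (MV * k + eps)) by rewrite C1E; ring.
  by rewrite !(mulr_ge0, addr_ge0)//; lra.
have lip k l b : 0 <= k <= 1 -> 0 <= l <= 1 -> `|y k b r - y l b r| <= L * `|k - l|.
  move=> k01 l01; have [y1 y2 pp qq] := yP k; have [y1' y2' pp' qq'] := yP l.
  pose z b x := y k b x - y l b x.
  pose h b t : R := if b then 0 else (k ^+ 2 - l ^+ 2) * y l true t.
  have rrr : - r <= r <= r by rewrite rr lexx.
  have := @linear_system_bound (- r) r K `|k - l| (2 * `|k - l| * (4 * W)) (c k) h z K0
      rr (mc k) (fun b t => cK k b t (abs01 k k01)).
  move=> bnd; apply: le_trans (bnd _ _ _ _ _ b r rrr) _.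
  - by case=> //=; apply: locintZ; exact: continuous_locint.
  - case=> t tr /=.
      by rewrite normr0 !mulr_ge0//; lra.
    rewrite normrM; apply: ler_pM => //; last exact: yW.
    rewrite subr_sqr mulrC normrM; apply: ler_wpM2r => //.
    by apply: le_trans (ler_normD _ _) _; have := abs01 k k01; have := abs01 l l01; lra.
  - by move=> d v; apply: cvgB; exact: cy.
  - by case; rewrite /z ?y1 ?y2 ?y1' ?y2' ?subrr ?normr0.
  - case=> v /andP[rv vr]; rewrite /z.
      have := AC_Int (ACB pp pp') rv => ->.
      by apply: eq_Int => t /andP[rt _]; rewrite /c /h chi1//=; ring.
    have := AC_Int (ACB qq qq') rv => ->.
    by apply: eq_Int => t /andP[rt _]; rewrite /c /h /Q chi1//=; ring.
  by rewrite LE -WE le_eqVlt; apply/orP; left; apply/eqP; ring.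
split=> [k k01|k l k01 l01].
  have [y1 y2 pp qq] := yP k; have /andP[k0 k1] := k01.
  split => //.
  have lV : locint V by apply: locint_locbnd => // s t; exists MV.
  have cu2 : continuous (fun t => u t ^+ 2).
    have -> : (fun t => u t ^+ 2) = (fun t => u t * u t) by apply/funext => t; rewrite
        expr2.
    by move=> t; apply: cvgM; exact: cu.
  have rrr : - r <= r <= r by rewrite rr lexx.
  have lVu : locint (fun t => V t * u t ^+ 2) by apply: locintMc.
  have lUu : locint (fun t => (Q k t - U t) * y k true t * u t).
    by do 2 (apply: locintMc => //); apply: locintB => //; apply: locint_locbnd => // s
        t; exists MU.
  have := wronskian rr uu dd pp qq; rewrite y1 y2 uA duA duB => w.
  have -> : u r * (y k false r + k * y k true r) - k * (1 + u r ^+ 2)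
          - eps * Int (fun t => V t * u t ^+ 2) (- r) r =
      k * u r * (y k true r - u r) +
      Int (fun t => (Q k t - U t) * y k true t * u t - eps * (V t * u t ^+ 2)) (- r) r.
    by rewrite (IntB _ _ lUu (locintZ eps lVu)) (IntZ _ _ _ lVu) -w; ring.
  apply: (@le_trans _ _ (D * (k + eps) ^+ 2)); last first.
    by apply: ler_wpM2r; [exact: sqr_ge0|lra].
  rewrite DE mulrDl; apply: le_trans (ler_normD _ _) _; apply: lerD.
    rewrite !normrM ger0_norm//.
    have -> : `|u r| * C1 * (k + eps) ^+ 2 = (k + eps) * `|u r| * (C1 * (k + eps)) by
        ring.
    apply: ler_pM => //; [by rewrite mulr_ge0|by apply: ler_wpM2r => //; lra|].
    exact: (yu k true r k01 rrr).
  have -> : (MV * C1 * Mu + 4 * W * Mu) * (2 * r) * (k + eps) ^+ 2 =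
    (MV * C1 * Mu + 4 * W * Mu) * (k + eps) ^+ 2 * (r - - r) by ring.
  apply: le_norm_Int_cst => //; first by apply: locintB => //; exact: locintZ.
  move=> t tr.
  have -> : (Q k t - U t) * y k true t * u t - eps * (V t * u t ^+ 2) =
    eps * (V t * (y k true t - u t) * u t) + k ^+ 2 * (y k true t * u t) by rewrite /Q;
        ring.
  apply: le_trans (ler_normD _ _) _.
  have h1 : `|eps * (V t * (y k true t - u t) * u t)| <= eps * (MV * (C1 * (k + eps)) *
      Mu).
    rewrite !normrM ger0_norm//; apply: ler_wpM2l => //; apply: ler_pM => //.
    by apply: ler_pM => //; exact: (yu k true t k01 tr).
  have h2 : `|k ^+ 2 * (y k true t * u t)| <= k ^+ 2 * (4 * W * Mu).
    rewrite !normrM ger0_norm ?sqr_ge0//; apply: ler_wpM2l; first exact: sqr_ge0.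
    by apply: ler_pM => //; exact: yW.
  apply: le_trans (lerD h1 h2) _.
  rewrite [leRHS]mulrDl; apply: lerD.
    have -> : eps * (MV * (C1 * (k + eps)) * Mu) = MV * C1 * Mu * (eps * (k + eps)) by
        ring.
    apply: ler_wpM2l; first by apply: mulr_ge0 => //; apply: mulr_ge0.
    by rewrite expr2; apply: ler_wpM2r; lra.
  rewrite mulrC; apply: ler_wpM2l; first by rewrite !mulr_ge0//; lra.
  by rewrite !expr2; apply: ler_pM => //; lra.
have rrr : - r <= r <= r by rewrite rr lexx.
have -> : (y k false r + k * y k true r) - (y l false r + l * y l true r) =
  (y k false r - y l false r) + (k * (y k true r - y l true r) + (k - l) * y l true r)
      by ring.
have h1 := lip k l false k01 l01; have h2 := lip k l true k01 l01.
have h3 := yW l true r l01 rrr; have k1 := abs01 k k01.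
have n1 : `|k * (y k true r - y l true r)| <= L * `|k - l|.
  by rewrite normrM -[leRHS]mul1r; apply: ler_pM.
have n2 : `|(k - l) * y l true r| <= 4 * W * `|k - l|.
  by rewrite normrM mulrC; apply: ler_wpM2r.
have n3 : 0 <= D * `|k - l| by rewrite mulr_ge0.
apply: le_trans (ler_normD _ _) _.
have n4 := ler_normD (k * (y k true r - y l true r)) ((k - l) * y l true r).
have -> : (D + L + L + 4 * W) * `|k - l| = D * `|k - l| + L * `|k - l| + L * `|k - l| +
    4 * W * `|k - l| by ring.
lra.
Qed.

End shooting.

(** * Behaviour outside the support, and eigenfunctions by matching *)

Section half_bound_state.
Context {R : realType}.
Implicit Types (U u du f : R -> R) (r k M x : R).

Lemma bounded_affine_slope0 (c d M : R) : (forall t, 0 <= t -> `|c + d * t| <= M) -> d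
    = 0.
Proof.
move=> H; apply/eqP; apply: contraT => d0.
have nd : 0 < `|d| by rewrite normr_gt0.
have M0 : 0 <= M by apply: le_trans (normr_ge0 _) (H 0 (lexx _)).
pose t := (M + `|c| + 1) / `|d|.
have t0 : 0 <= t by rewrite divr_ge0// !addr_ge0.
have := H t t0.
have dt : `|d * t| = M + `|c| + 1.
  by rewrite normrM (ger0_norm t0) /t mulrC divfK// gt_eqF.
have : `|d * t| <= `|c + d * t| + `|c|.
  have {1}-> : d * t = (c + d * t) - c by ring.
  exact: ler_normB.
rewrite dt; lra.
Qed.

(** Where [U] vanishes [u] is affine; boundedness kills the slope on each side, and the constant
    value is then the limit. *)
Lemma half_bound_state_outside U u du r M (theta : R) : 0 < r ->
  (forall x, r <= `|x| -> U x = 0) ->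
  AC_with_deriv u du -> AC_with_deriv du (fun t => U t * u t) ->
  (forall x, `|u x| <= M) -> u x @[x --> -oo] --> (1 : R) -> u x @[x --> +oo] --> theta ->
  [/\ u (- r) = 1, du (- r) = 0, u r = theta & du r = 0].
Proof.
move=> r0 U0 uu dd uM lm lp.
have dur x : r <= x -> du x = du r.
  move=> rx; apply/eqP; rewrite -subr_eq0 (AC_Int dd rx) (@eq_Int _ _ (fun=> 0)).
    by rewrite Int_cst// mul0r.
  by move=> t /andP[rt _]; rewrite U0 ?mul0r// ger0_norm//; lra.
have dul x : x <= - r -> du x = du (- r).
  move=> rx; apply/eqP; rewrite eq_sym -subr_eq0 (AC_Int dd rx) (@eq_Int _ _ (fun=> 0)).
    by rewrite Int_cst// mul0r.
  by move=> t /andP[_ rt]; rewrite U0 ?mul0r// ler0_norm//; lra.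
have ur x : r <= x -> u x = u r + du r * (x - r).
  move=> rx; have := AC_Int uu rx.
  rewrite (@eq_Int _ _ (fun=> du r)) ?Int_cst//; first by lra.
  by move=> t /andP[rt _]; exact: dur.
have ul x : x <= - r -> u x = u (- r) + du (- r) * (x + r).
  move=> rx; have := AC_Int uu rx.
  rewrite (@eq_Int _ _ (fun=> du (- r))) ?Int_cst//; first by lra.
  by move=> t /andP[_ rt]; exact: dul.
have dr0 : du r = 0.
  apply: (@bounded_affine_slope0 (u r) _ M) => t t0.
  have rt : r <= r + t by lra.
  by have := uM (r + t); rewrite (ur _ rt) (_ : r + t - r = t)//; ring.
have dl0 : du (- r) = 0.
  apply/eqP; rewrite -oppr_eq0; apply/eqP.
  apply: (@bounded_affine_slope0 (u (- r)) _ M) => t t0.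
  have rt : - r - t <= - r by lra.
  by have := uM (- r - t); rewrite (ul _ rt) (_ : du (- r) * _ = - du (- r) * t)//; ring.
split => //.
- apply: (@norm_cvg_unique _ _ (u x @[x --> -oo])) => //.
  apply: cvg_near_cst; near=> x.
  have xr : x <= - r by near: x; apply: nbhs_ninfty_le; exact: num_real.
  by rewrite (ul _ xr) dl0 mul0r addr0.
- apply: (@norm_cvg_unique _ _ (u x @[x --> +oo])) => //.
  apply: cvg_near_cst; near=> x.
  have xr : r <= x by near: x; apply: nbhs_pinfty_ge; exact: num_real.
  by rewrite (ur _ xr) dr0 mul0r addr0.
Unshelve. all: by end_near. Qed.

Lemma integrable_oneDsqrV : (leb R).-integrable setT (fun x => ((oneDsqr x)^-1)%:E).
Proof.
have c : continuous (fun x : R => (oneDsqr x)^-1) by exact: continuous_oneDsqrV.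
have p x : 0 <= (oneDsqr x)^-1 :> R by rewrite invr_ge0.
apply/integrableP; split.
  by apply/measurable_EFinP; exact: continuous_measurable_fun.
under eq_integral do rewrite gee0_abs ?lee_fin//.
rewrite (ge0_symfun_integralT p c); last by move=> x /=; rewrite /oneDsqr sqrrN.
by rewrite -set_itvcy integral0y_oneDsqr -EFinM ltry.
Qed.

(** From [expR (k |x|) >= 1 + k |x|] the square of the exponential dominates [c * (1 + x ^ 2)] with
    [c = min 1 (k ^ 2)], so the integrable function [(oneDsqr x)^-1] serves as majorant. *)
Lemma exponential_decay_L2 f (C k : R) : 0 < k -> rmeas f ->
  (forall x, `|f x| <= C * expR (- k * `|x|)) -> L2 f.
Proof.
move=> k0 mf fC; split => //.
have C0 : 0 <= C by have := le_trans (normr_ge0 _) (fC 0); rewrite pmulr_lge0// expR_gt0.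
pose c := Num.min 1 (k ^+ 2).
have c0 : 0 < c by rewrite lt_min ltr01 exprn_gt0.
have := integrableZl measurableT (C ^+ 2 / c) integrable_oneDsqrV.
apply: le_integrable => //.
- by apply/measurable_EFinP; apply: measurable_funX.
- move=> x _; rewrite -EFinM lee_fin.
  have o0 : 0 < oneDsqr x :> R by apply: lt_le_trans (oneDsqr_ge1 x).
  rewrite ger0_norm ?sqr_ge0// ger0_norm; last first.
    by rewrite mulr_ge0 ?invr_ge0 ?divr_ge0 ?sqr_ge0// ltW.
  rewrite -real_normK ?num_real//.
  apply: (@le_trans _ _ (C ^+ 2 * expR (- k * `|x|) ^+ 2)).
    by rewrite -exprMn; apply: lerXn2r; rewrite ?nnegrE// mulr_ge0// ltW// expR_gt0.
  rewrite -[leRHS]mulrA; apply: ler_wpM2l; first exact: sqr_ge0.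
  rewrite mulNr expRN exprVn -invfM lef_pV2 ?posrE ?mulr_gt0 ?exprn_gt0 ?expR_gt0//.
  have e1 := expR_ge1Dx (k * `|x|).
  have kx0 : 0 <= k * `|x| by rewrite mulr_ge0// ltW.
  apply: (@le_trans _ _ ((1 + k * `|x|) ^+ 2)); last first.
    by apply: lerXn2r; rewrite ?nnegrE ?(ltW (expR_gt0 _))//; lra.
  have -> : (1 + k * `|x|) ^+ 2 = 1 + k ^+ 2 * x ^+ 2 + 2 * (k * `|x|).
    by rewrite -[x ^+ 2]real_normK ?num_real//; ring.
  rewrite /oneDsqr mulrDr mulr1.
  have h1 : c <= 1 by rewrite /c ge_min lexx.
  have h2 : c * x ^+ 2 <= k ^+ 2 * x ^+ 2.
    by apply: ler_wpM2r; [exact: sqr_ge0|rewrite /c ge_min lexx orbT].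
  lra.
Qed.

Lemma AC_glue2 f df (c1 c2 : R) : c1 <= c2 -> locint df ->
  (forall x y, x <= y <= c1 -> f y - f x = Int df x y) ->
  (forall x y, c1 <= x <= y -> y <= c2 -> f y - f x = Int df x y) ->
  (forall x y, c2 <= x <= y -> f y - f x = Int df x y) ->
  AC_with_deriv f df.
Proof.
move=> c12 ldf H1 H2 H3; apply: (AC_glue ldf (c := c1)) => // x y /andP[cx xy].
have [yc|/ltW cy] := leP y c2; first by apply: H2; rewrite ?cx.
have [cx2|/ltW xc] := leP c2 x; first by apply: H3; rewrite ?cx2.
rewrite (Int_chasles ldf (y := c2)) ?xc//.
by rewrite -H2 ?cx// -H3 ?lexx//; ring.
Qed.

(* Outside [-r, r] the solution is continued by decaying exponentials; clamping
   the argument makes this a single formula. *)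
Lemma matched_solution_eigenvalue (W : R -> R) M r k (y : bool -> R -> R) : 0 < k -> 0
    < r ->
  rmeas W -> (forall x, `|W x| <= M) -> (forall x, r <= `|x| -> W x = 0) ->
  y true (- r) = 1 -> y false (- r) = k ->
  AC_with_deriv (y true) (fun t => chi (- r) t * y false t) ->
  AC_with_deriv (y false) (fun t => chi (- r) t * (W t + k ^+ 2) * y true t) ->
  y false r + k * y true r = 0 ->
  is_eigenvalue W (- k ^+ 2).
Proof.
move=> k0 r0 mW WM W0 y1 y2 pp qq match_r.
have rr : - r <= r by lra.
have cy b : continuous (y b) by case: b; [exact: AC_continuous pp|exact: AC_continuous
    qq].
pose clamp x : R := Num.max (- r) (Num.min x r).
pose el x := expR (k * (Num.min x (- r) - - r)).
pose er x := expR (- k * (Num.max x r - r)).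
(* [el] is 1 to the right of [- r] and [er] is 1 to the left of [r]: in each of the three regions at
   most one factor varies. *)
pose Z b x := el x * y b (clamp x) * er x.
have cmin (a : R) : continuous (fun x : R => Num.min x a).
  by move=> x; apply: continuous_min; [exact: cvg_id|exact: cvg_cst].
have cmax (a : R) : continuous (fun x : R => Num.max x a).
  by move=> x; apply: continuous_max; [exact: cvg_id|exact: cvg_cst].
have cclamp : continuous clamp.
  by move=> x; apply: (@continuous_max _ _ (fun=> - r) (fun x => Num.min x r) x);
      [exact: cvg_cst|exact: cmin].
have cE m s := AC_continuous (AC_expR m s : AC_with_deriv (fun x : R => expR (m * (x -
    s))) _).
have cel : continuous el.
  by move=> x; apply: (continuous_comp (cmin (- r) x) (cE k (- r) _)).
have cer : continuous er.
  by move=> x; apply: (continuous_comp (cmax r x) (cE (- k) r _)).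
have cZ b : continuous (Z b).
  move=> x; apply: cvgM; last exact: cer.
  apply: cvgM; first exact: cel.
  by apply: continuous_comp; [exact: cclamp|exact: cy].
have Zl b x : x <= - r -> Z b x = (if b then 1 else k) * expR (k * (x - - r)).
  move=> xr; rewrite /Z /el /er /clamp (min_idPl xr).
  have xr' : x <= r by lra.
  rewrite (min_idPl xr') (max_idPl xr) (max_idPr xr') subrr mulr0 expR0 mulr1 mulrC.
  by case: b; rewrite ?y1 ?y2.
have Zm b x : - r <= x <= r -> Z b x = y b x.
  move=> /andP[rx xr]; rewrite /Z /el /er /clamp (min_idPr rx) (min_idPl xr) (max_idPr
      rx) (max_idPr xr).
  by rewrite !subrr !mulr0 expR0 mul1r mulr1.
have Zr b x : r <= x -> Z b x = y b r * expR (- k * (x - r)).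
  move=> xr; rewrite /Z /el /er /clamp.
  have xr' : - r <= x by lra.
  by rewrite (min_idPr xr') (min_idPr xr) (max_idPr rr) (max_idPl xr) subrr mulr0 expR0
      mul1r.
(* The vanishing of the shooting function enters here: the derivative at [r] is that of the tail
   [y true r * expR (- k * (x - r))]. On the left the data (1, k) match by construction. *)
have yr : y false r = - k * y true r by move: match_r; lra.
have lW : locint (fun t => W t - - k ^+ 2).
  by apply: locintB; [apply: locint_locbnd => // s t; exists M|exact: locint_cst].
have AC1 : AC_with_deriv (Z true) (Z false).
  apply: (@AC_glue2 _ _ (- r) r) => //; first exact: continuous_locint.
  - move=> x v /andP[xv vr]; rewrite !Zl ?(le_trans xv)// !mul1r.
    rewrite (AC_Int (AC_expR k (- r)) xv); apply: eq_Int => t /andP[_ tv].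
    by rewrite Zl ?(le_trans tv).
  - move=> x v /andP[rx xv] vr; rewrite !Zm; [|by apply/andP; split; lra..].
    rewrite (AC_Int pp xv); apply: eq_Int => t /andP[xt tv].
    by rewrite Zm ?chi1 ?mul1r//; first (by lra); apply/andP; split; lra.
  - move=> x v /andP[rx xv]; rewrite !Zr ?(le_trans rx)//.
    rewrite (AC_Int (ACZ (y true r) (AC_expR (- k) r)) xv); apply: eq_Int => t /andP[xt
        _].
    by rewrite Zr ?(le_trans rx)// yr; ring.
have AC2 : AC_with_deriv (Z false) (fun t => (W t - - k ^+ 2) * Z true t).
  apply: (@AC_glue2 _ _ (- r) r) => //; first exact: locintMc.
  - move=> x v /andP[xv vr]; rewrite !Zl ?(le_trans xv)//.
    rewrite (AC_Int (ACZ k (AC_expR k (- r))) xv); apply: eq_Int => t /andP[_ tv].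
    have tr : t <= - r by exact: le_trans vr.
    by rewrite Zl// W0; [ring|rewrite ler0_norm; lra].
  - move=> x v /andP[rx xv] vr; rewrite !Zm; [|by apply/andP; split; lra..].
    rewrite (AC_Int qq xv); apply: eq_Int => t /andP[xt tv].
    by rewrite Zm ?chi1 ?mul1r ?opprK//; first (by lra); apply/andP; split; lra.
  - move=> x v /andP[rx xv]; rewrite !Zr ?(le_trans rx)//.
    rewrite (AC_Int (ACZ (y false r) (AC_expR (- k) r)) xv); apply: eq_Int => t
        /andP[xt _].
    have rt : r <= t by exact: le_trans xt.
    by rewrite Zr// W0; [rewrite yr; ring|rewrite ger0_norm; lra].
have [C1 HC1] := continuous_locbnd (cy true) (- r) r.
have [C2 HC2] := continuous_locbnd (cy false) (- r) r.
pose C := `|C1| + `|C2|.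
have yC b x : - r <= x <= r -> `|y b x| <= C.
  case: b => [/HC1|/HC2] h; rewrite /C.
    by have := ler_norm C1; have := normr_ge0 C2; lra.
  by have := ler_norm C2; have := normr_ge0 C1; lra.
have ZC b x : `|Z b x| <= C * expR (k * r) * expR (- k * `|x|).
  have -> : Z b x = y b (clamp x) * (el x * er x) by rewrite /Z; ring.
  rewrite normrM -mulrA; apply: ler_pM => //.
    apply: yC; rewrite /clamp le_max lexx/= ge_max rr/= ge_min lexx orbT//.
  rewrite /el /er -!expRD ger0_norm ?(ltW (expR_gt0 _))// ler_expR.
  rewrite !mulNr -!mulrBr; apply: ler_wpM2l; first exact: ltW.
  have [x0|x0] := leP 0 x.
    rewrite ger0_norm// (@min_idPr _ _ x (- r) _); last by lra.
    have : x <= Num.max x r by rewrite le_max lexx.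
    lra.
  rewrite ltr0_norm// (@max_idPr _ _ x r _); last by lra.
  have : Num.min x (- r) <= x by rewrite ge_min lexx.
  lra.
have MM : 0 <= M by apply: le_trans (normr_ge0 _) (WM 0).
exists (Z true), (Z false); split; [split => //|split; [|split; [|split]]].
- exact: AC_is_derive.
- by apply: (exponential_decay_L2 k0 _ (ZC true)); exact: continuous_rmeas.
- by apply: (exponential_decay_L2 k0 _ (ZC false)); exact: continuous_rmeas.
- apply: (@exponential_decay_L2 _ ((M + k ^+ 2) * (C * expR (k * r))) k) => //.
    apply: measurable_funM; last exact: continuous_rmeas.
    by apply: measurable_funB => //; exact: measurable_cst.
  move=> x; rewrite normrM -[leRHS]mulrA; apply: ler_pM => //.
  apply: le_trans (ler_normB _ _) _; rewrite normrN [X in _ + X]ger0_norm ?sqr_ge0//.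
  by rewrite lerD2r.
- by exists (- r); rewrite Zm ?y1 ?oner_neq0// lexx.
Qed.

End half_bound_state.

(** * Support of a derivative known almost everywhere *)

Section support_of_derivative.
Context {R : realType}.
Implicit Types (f df : R -> R).

Lemma locint_locally_integrable f : rmeas f -> locint f -> locally_integrable setT f.
Proof.
move=> mf lf; split => //; first exact: openT.
move=> K _ cK.
have [N [_ HN]] := compact_bounded cK.
have KN : K `<=` `[- (`|N| + 1), `|N| + 1].
  move=> x Kx /=; rewrite in_itv/= -ler_norml; apply: HN => //.
  by have := ler_norm N; lra.
have /integrableP[_] := lf (- (`|N| + 1)) (`|N| + 1).
apply: le_lt_trans; apply: ge0_subset_integral => //.
- exact: compact_measurable.
- by apply/measurable_EFinP; apply: measurableT_comp => //; exact: measurable_funTS.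
Qed.

(** [df] may be altered on a null set, so it need not vanish everywhere off the support of [f]. At a
    Lebesgue point of [df] its value is the derivative of its primitive, which is constant near [x]
    if [f] is zero there. *)
Lemma AC_deriv_ae0 f df : rmeas df -> AC_with_deriv f df ->
  {ae leb R, forall x, (\forall t \near x, f t = 0) -> df x = 0}.
Proof.
move=> mdf ff; have ldf := AC_locint ff.
have := lebesgue_differentiation (locint_locally_integrable mdf ldf).
apply: filterS; first exact: (ae_filter_ringOfSetsType (leb R)).
move=> x lx f0.
have x1 : x < x + 1 by lra.
have x2 : x - 1 < x by lra.
have [_ <-] := @FTC1_lebesgue_pt R df (BLeft (x - 1)) x (x + 1) x1 (ldf (x - 1) (x +
    1)) x2 lx.
rewrite derive1E (@near_eq_derive _ _ _ _ (fun=> - f (x - 1))) ?derive_cst//.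
near=> t.
have xt : x - 1 <= t by near: t; apply: lt_le_nbhsr; lra.
have ft : f t = 0 by near: t.
by rewrite -/(Int df (x - 1) t) -(AC_Int ff xt) ft sub0r.
Unshelve. all: by end_near. Qed.

Lemma integral_ae_compact_support f r : rmeas f ->
  {ae leb R, forall x, r < `|x| -> f x = 0} -> \int[leb R]_x f x = Int f (- r) r.
Proof.
move=> mf f0; rewrite /Int [RHS]Rintegral_mkcond /Rintegral; congr fine.
have mr : measurable_fun setT (f \_ `[- r, r]) by apply/(measurable_restrictT _ _).1 =>
    //; exact: measurable_funTS.
apply: ae_eq_integral => //.
- exact/measurable_EFinP.
- exact/measurable_EFinP.
move: f0; apply: filterS; first exact: (ae_filter_ringOfSetsType (leb R)).
move=> x fx _; rewrite patchE; case: ifPn => //; rewrite notin_setE/= in_itv/= => /negP.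
by rewrite -ler_norml -ltNge => /fx ->.
Qed.

End support_of_derivative.

(** * Intermediate values on an interval *)

Section lipschitz.
Context {R : realType}.

(** [f] is controlled on [a, b] only; composing it with the clamp onto [a, b] gives a continuous
    function on the line. The sign change is a product because the sign of [theta], hence the
    direction of the crossing, is unknown. *)
Lemma lipschitz_IVT (f : R -> R) (C a b : R) : a <= b ->
  (forall x y, a <= x <= b -> a <= y <= b -> `|f x - f y| <= C * `|x - y|) ->
  f a * f b <= 0 -> exists2 c, a <= c <= b & f c = 0.
Proof.
move=> ab fC fab.
have C0 : a < b -> 0 <= C.
  move=> ltab; have := le_trans (normr_ge0 _) (fC a b _ _); rewrite !lexx ab => /(_ isT
      isT).
  by rewrite pmulr_lge0// normr_gt0 subr_eq0 lt_eqF.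
move: ab; rewrite le_eqVlt => /predU1P[eab|ltab].
  exists a; first by rewrite eab lexx.
  apply/eqP; rewrite -sqrf_eq0 eq_le sqr_ge0 andbT.
  by move: fab; rewrite -eab expr2.
have {}C0 := C0 ltab.
pose cl x : R := Num.max a (Num.min x b).
have clab x : a <= cl x <= b by rewrite /cl le_max lexx/= ge_max (ltW ltab)/= ge_min
    lexx orbT.
have cl_lip x y : `|cl x - cl y| <= `|x - y|.
  wlog xy : x y / x <= y.
    by move=> H; have [/H//|/ltW /H] := leP x y; rewrite distrC [X in _ <= X]distrC.
  rewrite (ler0_norm (_ : x - y <= 0)); last by lra.
  rewrite /cl; set v := Num.min x b; set w := Num.min y b.
  have [vw wv] : v <= w /\ w - v <= y - x.
    by rewrite /v /w; case: (leP x b) => xb; case: (leP y b) => yb; split; lra.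
  by case: (leP a v) => av; case: (leP a w) => aw; rewrite ler_norml; apply/andP;
      split; lra.
have cg : continuous (f \o cl).
  move=> x; apply/cvgrPdist_le => e e0.
  have d0 : 0 < e / (C + 1) by rewrite divr_gt0// ltr_wpDl.
  near=> t.
  have xt : `|x - t| <= e / (C + 1) by near: t; exact: cvgr_dist_le.
  apply: le_trans (fC _ _ (clab x) (clab t)) _.
  apply: le_trans (ler_wpM2l C0 (le_trans (cl_lip x t) xt)) _.
  rewrite mulrCA ger_pMr// ler_pdivrMr ?ltr_wpDl//; lra.
have fcl x : a <= x <= b -> (f \o cl) x = f x.
  by move=> /andP[ax xb]; rewrite /= /cl (min_idPl xb) (max_idPr ax).
have fa : (f \o cl) a = f a by apply: fcl; rewrite lexx ltW.
have fb : (f \o cl) b = f b by apply: fcl; rewrite lexx ltW.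
have [] := @IVT _ (f \o cl) a b 0 (ltW ltab).
- exact: continuous_subspaceT.
- rewrite fa fb ge_min le_max; move: fab.
  have [f0|f0] := leP (f a) 0; have [f1|f1] := leP (f b) 0 => //=; rewrite ?(ltW f0)
      ?(ltW f1) ?orbT// => H.
  + apply: contraT; rewrite negb_or -!ltNge => /andP[fa0 fb0].
    by move: H; rewrite leNgt nmulr_rgt0// fb0.
  + by move: H; rewrite leNgt mulr_gt0.
- by move=> c; rewrite in_itv/= => cab fc; exists c => //; rewrite -fcl.
Unshelve. all: by end_near. Qed.

End lipschitz.

(** * Asymptotics as the coupling tends to zero *)

Section threshold.
Context {R : realType}.

Lemma near_coupling (alpha : R -> R) (a e : R) :
  alpha l @[l --> 0^'+] --> a ->
  (l `^ (- 3^-1) * (alpha l - a)) @[l --> 0^'+] --> +oo ->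
  0 < e -> \forall l \near 0^'+,
  [/\ 0 < l, l <= e, 0 < alpha l - a, alpha l - a <= e & l <= e * (alpha l - a)].
Proof.
move=> alpha_a fast e0; near=> l.
have l0 : 0 < l by near: l; exact: nbhs_right_gt.
have le : l <= e by near: l; exact: nbhs_right_le.
have l1 : l <= 1 by near: l; exact: nbhs_right_le.
have big : e^-1 <= l `^ (- 3^-1) * (alpha l - a) by near: l; move/cvgryPge : fast; exact.
have d0 : 0 < alpha l - a.
  have p0 : 0 < l `^ (- 3^-1) by exact: powR_gt0.
  by rewrite -(pmulr_rgt0 _ p0); apply: lt_le_trans big; rewrite invr_gt0.
split => //.
  have : `|a - alpha l| <= e by near: l; exact: cvgr_dist_le.
  by rewrite distrC ger0_norm// ltW.
have : l `^ (- 3^-1) <= l^-1.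
  rewrite -[leRHS]powR_inv1 ?(ltW l0)//; apply: ger_powR; first by rewrite l0.
  by rewrite lerN2 invf_le1//; lra.
move=> /(ler_wpM2r (ltW d0)) /(le_trans big).
rewrite mulrC ler_pdivlMr// mulrC ler_pdivrMr// mulrC.
by [].
Unshelve. all: by end_near. Qed.

(** All errors are measured against [l * (alpha l - a)], the expected order of [k]. In the
    application [G s] is [s] times the integral of [V (s x) u ^ 2], and [A] its derivative at
    [a]. *)
Lemma near_error (alpha G : R -> R) (a A C m0 e : R) :
  alpha l @[l --> 0^'+] --> a ->
  (l `^ (- 3^-1) * (alpha l - a)) @[l --> 0^'+] --> +oo ->
  0 < a -> 0 <= C -> 0 < m0 ->
  (forall e : R, 0 < e -> exists2 d : R, 0 < d & forall s, `|s - a| <= d ->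
    `|G s - (s - a) * A| <= e * `|s - a|) ->
  0 < e -> \forall l \near 0^'+, [/\ 0 < l * (alpha l - a), l * alpha l <= 1,
    2 * m0 * (l * (alpha l - a)) <= 1, `|l * G (alpha l) - l * (alpha l - a) * A| <= e
        * (l * (alpha l - a)) &
    forall k, 0 <= k <= 2 * m0 * (l * (alpha l - a)) ->
      C * (k + l * alpha l) ^+ 2 <= e * (l * (alpha l - a))].
Proof.
move=> alpha_a fast a0 C0 m00 GA e0.
have [d d0 Gd] := GA e e0.
pose B := (2 * m0 + a + 1) ^+ 2.
have B0 : 0 <= B by exact: sqr_ge0.
have CB0 : 0 < C * B + 1 by rewrite ltr_wpDl// mulr_ge0.
(* In order: the expansion of [G] applies; [alpha l <= a + 1], so that
   [k + l * alpha l <= l * (2 * m0 + a + 1)]; the quadratic error [C * B * l ^ 2] is small against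
   [l * (alpha l - a)]; and both [l * alpha l] and the range of [k] stay below 1. *)
pose q := Num.min (Num.min d 1) (Num.min (e / (C * B + 1)) (2 * m0 + a + 1)^-1).
have q0 : 0 < q by rewrite /q !lt_min d0 ltr01 divr_gt0//= invr_gt0; lra.
have [qd q1 qe qm] : [/\ q <= d, q <= 1, q <= e / (C * B + 1) & q <= (2 * m0 + a + 1)^-1].
  by rewrite /q !ge_min !lexx ?orbT.
near=> l.
have [l0 lq dl0 dlq ldl] : [/\ 0 < l, l <= q, 0 < alpha l - a, alpha l - a <= q & l <=
    q * (alpha l - a)].
  by near: l; exact: near_coupling.
set dl := alpha l - a in dl0 dlq ldl *.
have s0 : 0 <= alpha l by move: dl0; rewrite /dl; lra.
have lm : l * (2 * m0 + a + 1) <= 1.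
  by rewrite -ler_pdivlMr ?div1r; [exact: le_trans lq qm|lra].
have dl1 : dl <= 1 by exact: le_trans q1.
have sa : alpha l <= a + 1 by move: dl1; rewrite /dl; lra.
split.
- by rewrite mulr_gt0.
- by apply: le_trans lm; apply: ler_wpM2l; lra.
- have -> : 2 * m0 * (l * dl) = l * (2 * m0 * dl) by ring.
  apply: le_trans lm; apply: ler_wpM2l; first exact: ltW.
  have : 2 * m0 * dl <= 2 * m0 * 1 by apply: ler_wpM2l => //; lra.
  lra.
- have := Gd (alpha l); rewrite -/dl ger0_norm ?(ltW dl0)// => /(_ (le_trans dlq qd)) h.
  rewrite -mulrA -mulrBr normrM (ger0_norm (ltW l0)) mulrCA.
  by apply: ler_wpM2l => //; exact: ltW.
move=> k /andP[k0 kl].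
have k2 : k + l * alpha l <= l * (2 * m0 + a + 1).
  have h1 : 2 * m0 * (l * dl) <= l * (2 * m0).
    rewrite mulrCA; apply: ler_wpM2l; first exact: ltW.
    by rewrite -[leRHS]mulr1; apply: ler_wpM2l => //; lra.
  have h2 : l * alpha l <= l * (a + 1) by apply: ler_wpM2l => //; exact: ltW.
  have -> : l * (2 * m0 + a + 1) = l * (2 * m0) + l * (a + 1) by ring.
  lra.
have ls0 : 0 <= l * alpha l by rewrite mulr_ge0// ltW.
apply: (@le_trans _ _ (C * (l ^+ 2 * B))).
  apply: ler_wpM2l => //; rewrite /B -exprMn; apply: lerXn2r; rewrite ?nnegrE//; first
      by lra.
  by rewrite mulr_ge0//; lra.
have h : l * (C * B + 1) <= e * dl.
  apply: (@le_trans _ _ (q * dl * (C * B + 1))); first by apply: ler_wpM2r => //;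
      exact: ltW.
  rewrite mulrAC; apply: ler_wpM2r; first exact: ltW.
  by rewrite -ler_pdivlMr.
apply: (@le_trans _ _ (l * (l * (C * B + 1)))).
  have -> : C * (l ^+ 2 * B) = l * (l * (C * B)) by ring.
  by apply: ler_wpM2l; [exact: ltW|apply: ler_wpM2l; [exact: ltW|lra]].
by rewrite [leRHS]mulrCA; apply: ler_wpM2l => //; exact: ltW.
Unshelve. all: by end_near. Qed.

(** With [n = m0 * ld] and [q = n * T], [theta * F] is about [k * T - q], that is [- q / 2] at
    [n / 2] and [q / 2] at [3 n / 2]. The two tolerances of [q / 8] add up to [q / 4], so the signs
    persist. The bound with [err k] is returned because it later yields the sharp asymptotics of the
    root. *)
Lemma shooting_root (F : R -> R) (theta T m0 ld g L : R) (err : R -> R) : theta != 0 ->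
  0 < T -> 0 < m0 -> 0 < ld -> 2 * m0 * ld <= 1 ->
  `|g - - (m0 * T) * ld| <= m0 * T / 8 * ld ->
  (forall k, 0 <= k <= 1 -> `|theta * F k - k * T - g| <= err k) ->
  (forall k, 0 <= k <= 2 * m0 * ld -> err k <= m0 * T / 8 * ld) ->
  (forall k l, 0 <= k <= 1 -> 0 <= l <= 1 -> `|F k - F l| <= L * `|k - l|) ->
  exists k, [/\ 0 < k, k <= 2 * m0 * ld, F k = 0 & `|k * T + g| <= err k].
Proof.
move=> th0 T0 m00 ld0 ml1 gE FE errE FL.
have [q qE] : exists q, q = m0 * T * ld by eexists.
have q0 : 0 < q by rewrite qE !mulr_gt0.
have [n nE] : exists n, n = m0 * ld by eexists.
have n0 : 0 < n by rewrite nE mulr_gt0.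
have m2 : 2 * m0 * ld = 2 * n by rewrite nE mulrA.
have q8 : m0 * T / 8 * ld = q / 8 by rewrite qE; field.
rewrite {}m2 in ml1 errE *; rewrite {}q8 in gE errE.
rewrite mulNr opprK -qE in gE.
have nT : n * T = q by rewrite nE qE; ring.
have in01 k : n / 2 <= k <= 3 / 2 * n -> 0 <= k <= 1.
  by move=> /andP[h1 h2]; apply/andP; split; lra.
have in2 k : n / 2 <= k <= 3 / 2 * n -> 0 <= k <= 2 * n.
  by move=> /andP[h1 h2]; apply/andP; split; lra.
have sgn k : n / 2 <= k <= 3 / 2 * n -> `|theta * F k - (k * T - q)| <= q / 4.
  move=> kk; have h := le_trans (FE k (in01 k kk)) (errE k (in2 k kk)).
  have -> : theta * F k - (k * T - q) = (theta * F k - k * T - g) + (g + q) by ring.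
  apply: le_trans (ler_normD _ _) _; lra.
have k12 : n / 2 <= 3 / 2 * n by lra.
have F1 : theta * F (n / 2) < 0.
  have := sgn (n / 2); rewrite lexx k12 => /(_ isT); rewrite ler_norml => /andP[_].
  have -> : n / 2 * T = q / 2 by rewrite -nT; field.
  lra.
have F2 : 0 < theta * F (3 / 2 * n).
  have := sgn (3 / 2 * n); rewrite lexx k12 => /(_ isT); rewrite ler_norml => /andP[+ _].
  have -> : 3 / 2 * n * T = 3 / 2 * q by rewrite -nT; field.
  lra.
have F12 : F (n / 2) * F (3 / 2 * n) <= 0.
  have : (theta * F (n / 2)) * (theta * F (3 / 2 * n)) <= 0 by apply: ltW; rewrite
      pmulr_llt0.
  have -> : (theta * F (n / 2)) * (theta * F (3 / 2 * n)) =
    theta ^+ 2 * (F (n / 2) * F (3 / 2 * n)) by ring.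
  by rewrite pmulr_rle0// exprn_even_gt0.
have FL' x y : n / 2 <= x <= 3 / 2 * n -> n / 2 <= y <= 3 / 2 * n -> `|F x - F y| <= L
    * `|x - y|.
  by move=> hx hy; apply: FL; exact: in01.
have [k kk Fk] := lipschitz_IVT k12 FL' F12.
exists k; split => //.
- by have /andP[h _] := kk; lra.
- by have /andP[_] := in2 k kk.
- by have := FE k (in01 k kk); rewrite Fk mulr0 sub0r -opprD normrN.
Qed.

End threshold.

Theorem theorem2 (R : realType) (U V dV : R -> R) (alpha : R -> R) (a : R)
  (u : R -> R) (theta : R) :
  Linfty U -> compact_support U ->
  Linfty V -> W21_with_deriv V dV -> compact_support V ->
  (forall l : R, 0 < l -> 0 < alpha l) ->
  0 < a -> alpha l @[l --> 0^'+] --> a ->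
  normalized_half_bound_state U u ->
  u x @[x --> +oo] --> theta ->
  \int[leb R]_x (V (a * x) * u x ^+ 2) = 0 ->
  \int[leb R]_x (x * dV (a * x) * u x ^+ 2) < 0 ->
  (l `^ (- 3^-1) * (alpha l - a)) @[l --> 0^'+] --> +oo ->
  exists l0 : R, 0 < l0 /\
  exists e : R -> R,
    (forall l : R, 0 < l < l0 ->
       e l < 0 /\
       is_eigenvalue (fun x => U x + l * alpha l * V (alpha l * x)) (e l)) /\
    e l @[l --> 0^'+] --> (0 : R) /\
    (e l / (l ^+ 2 * (alpha l - a) ^+ 2)) @[l --> 0^'+] -->
      - (a / (theta ^+ 2 + 1) * \int[leb R]_x (x * dV (a * x) * u x ^+ 2)) ^+ 2.
Proof.
move=> [mU [MU UM]] [rU U0] [mV [MV VM]] [_ [L2dV VV]] [rV V0] alpha0 a0 alpha_a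
  [[du [du1 du2]] [[Mu uM] um]] up phi0 I0 fast.
have cdu := AC_continuous du2.
have uu := C1_AC du1 cdu.
have dd : AC_with_deriv du (fun t => U t * u t).
  by apply: eq_AC du2 => // t; rewrite subr0.
have cu := AC_continuous uu; have cV := AC_continuous VV.
have [mdV _] := L2dV.
have MV0 : 0 <= MV by apply: le_trans (normr_ge0 _) (VM 0).
(* Chosen so that [r > rU] and [a / 2 * r > rV]; the latter covers every dilation factor
   [s >= a / 2]. *)
have [r rE] : exists r : R, r = `|rU| + 2 * `|rV| / a + 1 by eexists.
have rVa0 : 0 <= 2 * `|rV| / a by rewrite divr_ge0 ?mulr_ge0// ltW.
have r0 : 0 < r by rewrite rE ltr_wpDl// addr_ge0.
have Ur x : r <= `|x| -> U x = 0.
  by move=> rx; apply: U0; have := ler_norm rU; move: rx; rewrite rE; lra.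
have Vr x : a / 2 * r <= `|x| -> V x = 0.
  move=> rx; apply: V0; apply: (le_lt_trans (ler_norm rV)); apply: lt_le_trans rx.
  have -> : a / 2 * r = `|rV| + (a / 2 * `|rU| + a / 2) by rewrite rE; field; rewrite
      gt_eqF.
  by rewrite ltrDl ltr_wpDl ?divr_gt0// mulr_ge0// divr_ge0// ltW.
have Vsr s x : a / 2 <= s -> r <= `|x| -> V (s * x) = 0.
  move=> as_ rx; apply: Vr; rewrite normrM; apply: ler_pM => //; [|exact: ltW|].
    by rewrite divr_ge0// ltW.
  exact: le_trans (ler_norm s).
have [uA duA uB duB] := half_bound_state_outside r0 Ur uu dd uM um up.
have rr : - r <= r by lra.
have th0 : theta != 0 by rewrite -uB; exact: (half_bound_state_neq0 rr mU UM uu dd).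
have cu2 : continuous (fun x => u x ^+ 2).
  have -> : (fun t => u t ^+ 2) = (fun t => u t * u t) by apply/funext => t; rewrite
      expr2.
  by move=> t; apply: cvgM; exact: cu.
pose phi s := Int (fun x => V (s * x) * u x ^+ 2) (- r) r.
have phia : phi a = 0.
  rewrite /phi -integral_compact_support ?(ltW r0)// => t rt.
  by rewrite Vsr ?mul0r//; [lra|exact: ltW].
pose J := \int[leb R]_x (x * dV (a * x) * u x ^+ 2).
have mdil : rmeas (fun x => dV (a * x)).
  apply: (measurableT_comp mdV); apply: continuous_rmeas => t.
  by apply: cvgM; [exact: cvg_cst|exact: cvg_id].
(* [dV] is known to vanish off the support only almost everywhere, so the integral is reduced to
   [-r, r] through [AC_deriv_ae0] for the dilated potential. *)
have JE : J = Int (fun x => x * dV (a * x) * u x ^+ 2) (- r) r.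
  apply: integral_ae_compact_support.
    apply: measurable_funM; last exact: continuous_rmeas.
    by apply: measurable_funM => //; exact: measurable_id.
  have madil : rmeas (fun x => a * dV (a * x)) by apply: measurable_funM => //; exact:
      measurable_cst.
  have := AC_deriv_ae0 madil (AC_dilation a0 mdV VV).
  apply: filterS; first exact: (ae_filter_ringOfSetsType (leb R)).
  move=> x dV0 rx.
  suff : a * dV (a * x) = 0.
    by move=> /eqP; rewrite mulf_eq0 gt_eqF//= => /eqP ->; rewrite mulr0 mul0r.
  apply: dV0; near=> t; apply: Vsr; first by lra.
  by near: t; apply: (cvgr_ge `|x|) => //; exact: norm_continuous.
have GA : forall e : R, 0 < e -> exists2 d : R, 0 < d & forall s, `|s - a| <= d ->
    `|s * phi s - (s - a) * (a * J)| <= e * `|s - a|.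
  move=> e e0; have [d d0 H] := dilated_potential_expansion a0 r0 VV L2dV Vr uu cdu e0.
  exists d => // s /H; rewrite -!/(phi _) phia mulr0 subr0 add0r -JE.
  by [].
have [T TE] : exists T, T = 1 + theta ^+ 2 by eexists.
(* The expected limit of [k / (l * (alpha l - a))]. *)
have [m0 m0E] : exists m, m = - (a * J) / T by eexists.
have T0 : 0 < T by rewrite TE ltr_pwDl// sqr_ge0.
have aJ : a * J < 0 by rewrite pmulr_rlt0.
have m00 : 0 < m0 by rewrite m0E divr_gt0// oppr_gt0.
have m0T : m0 * T = - (a * J) by rewrite m0E divfK// gt_eqF.
have [C C0 shoot] := shooting_function r0 mU UM uu dd uA duA duB uM MV0.
pose W l x := U x + l * alpha l * V (alpha l * x).
pose P l k := [/\ 0 < k, k <= 2 * m0 * (l * (alpha l - a)), is_eigenvalue (W l) (- k ^+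
    2) &
  `|k * T + l * (alpha l * phi (alpha l))| <= C * (k + l * alpha l) ^+ 2].
have exP : \forall l \near 0^'+, exists k, P l k.
  have e0 : 0 < m0 * T / 8 by rewrite divr_gt0// mulr_gt0.
  near=> l.
  have [l0 _ d0 _ _] : [/\ 0 < l, l <= 1, 0 < alpha l - a, alpha l - a <= 1 & l <= 1 *
      (alpha l - a)].
    by near: l; exact: near_coupling.
  have [ld0 ls1 lm1 GAl Cl] : [/\ 0 < l * (alpha l - a), l * alpha l <= 1,
      2 * m0 * (l * (alpha l - a)) <= 1,
      `|l * (alpha l * phi (alpha l)) - l * (alpha l - a) * (a * J)| <= m0 * T / 8 * (l
          * (alpha l - a)) &
    forall k, 0 <= k <= 2 * m0 * (l * (alpha l - a)) ->
      C * (k + l * alpha l) ^+ 2 <= m0 * T / 8 * (l * (alpha l - a))].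
    by near: l; exact: (near_error (G := fun s => s * phi s)).
  have s0 := alpha0 l l0.
  have ls0 : 0 <= l * alpha l <= 1 by rewrite ls1 mulr_ge0// ltW.
  have mVl : rmeas (fun x => V (alpha l * x)).
    apply: (measurableT_comp mV); apply: continuous_rmeas => t.
    by apply: cvgM; [exact: cvg_cst|exact: cvg_id].
  have [y [yP yL]] := shoot _ _ mVl (fun t => VM _) ls0.
  have [||||k [k0 kld Fk kE]] := @shooting_root _ (fun k => y k false r + k * y k true
      r) theta T m0
      (l * (alpha l - a)) (l * (alpha l * phi (alpha l))) C (fun k => C * (k + l *
          alpha l) ^+ 2)
      th0 T0 m00 ld0 lm1.
  - have -> : - (m0 * T) * (l * (alpha l - a)) = l * (alpha l - a) * (a * J) by rewrite
      m0T; ring.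
    exact: GAl.
  - move=> k k01; have [_ _ _ _] := yP k k01.
    by rewrite uB -/(phi (alpha l)) -TE mulrA.
  - exact: Cl.
  - exact: yL.
  have k01 : 0 <= k <= 1 by rewrite (ltW k0) (le_trans kld lm1).
  have [y1 y2 pp qq _] := yP k k01.
  exists k; split => //.
  apply: (@matched_solution_eigenvalue _ _ (MU + MV) r k (y k)) => //.
  - by apply: measurable_funD => //; apply: measurable_funM => //; exact: measurable_cst.
  - move=> x; apply: le_trans (ler_normD _ _) _; apply: lerD => //.
    have /andP[h1 h2] := ls0.
    by rewrite normrM (ger0_norm h1) -[leRHS]mul1r; apply: ler_pM.
  - move=> x rx; rewrite /W Ur// Vsr ?mulr0 ?addr0//.
    by move: d0; lra.
(* Where no root exists [K l] is the dummy value 0; this happens for no small [l]. *)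
have /choice[K KP] : forall l, exists k, (exists k', P l k') -> P l k.
  by move=> l; have [[k Pk]|nP] := pselect (exists k, P l k); [exists k|exists 0].
have nearP : \forall l \near 0^'+, P l (K l) by move: exP; apply: filterS => l; exact: KP.
have [l0 /= l00 Hl0] := nearP.
exists l0; split => //; exists (fun l => - K l ^+ 2).
(* The tolerance [e * T / 2] is spent twice, on the shooting error and on the expansion of the
   integral; dividing by [T * ld] leaves [e]. *)
have near_m : (K l / (l * (alpha l - a))) @[l --> 0^'+] --> m0.
  apply/cvgrPdist_le => e e0.
  have eT0 : 0 < e * T / 2 by rewrite divr_gt0// mulr_gt0.
  near=> l.
  have [ld0 _ _ GAl Cl] : [/\ 0 < l * (alpha l - a), l * alpha l <= 1,
      2 * m0 * (l * (alpha l - a)) <= 1,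
      `|l * (alpha l * phi (alpha l)) - l * (alpha l - a) * (a * J)| <= e * T / 2 * (l
          * (alpha l - a)) &
    forall k, 0 <= k <= 2 * m0 * (l * (alpha l - a)) ->
      C * (k + l * alpha l) ^+ 2 <= e * T / 2 * (l * (alpha l - a))].
    by near: l; exact: (near_error (G := fun s => s * phi s)).
  have [K0 Kld _ KE] : P l (K l) by near: l.
  have [ld ldE] : exists ld, ld = l * (alpha l - a) by eexists.
  rewrite -ldE in ld0 GAl Cl Kld *.
  have {}Cl := Cl (K l); rewrite (ltW K0) Kld in Cl.
  have h1 := le_trans KE (Cl isT).
  have h : `|K l * T + ld * (a * J)| <= e * T * ld.
    have -> : K l * T + ld * (a * J) = (K l * T + l * (alpha l * phi (alpha l)))
      - (l * (alpha l * phi (alpha l)) - ld * (a * J)) by ring.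
    apply: le_trans (ler_normB _ _) _; apply: le_trans (lerD h1 GAl) _.
    by rewrite le_eqVlt; apply/orP; left; apply/eqP; field.
  have Tld : 0 < T * ld by rewrite mulr_gt0.
  rewrite distrC -(ler_pM2r Tld) -[X in _ * X <= _](ger0_norm (ltW Tld)) -normrM.
  have -> : (K l / ld - m0) * (T * ld) = K l * T - m0 * T * ld by field; rewrite gt_eqF.
  by rewrite m0T mulNr opprK mulrA [a * J * ld]mulrC.
have ratio : (- K l ^+ 2 / (l ^+ 2 * (alpha l - a) ^+ 2)) @[l --> 0^'+] -->
    - (a / (theta ^+ 2 + 1) * J) ^+ 2.
  have -> : - (a / (theta ^+ 2 + 1) * J) ^+ 2 = - (m0 * m0).
    by rewrite m0E [theta ^+ 2 + 1]addrC -TE; field; rewrite gt_eqF.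
  have -> : (fun l => - K l ^+ 2 / (l ^+ 2 * (alpha l - a) ^+ 2)) =
    (fun l => - ((K l / (l * (alpha l - a))) * (K l / (l * (alpha l - a))))).
    by apply/funext => l; rewrite -expr2 expr_div_n exprMn mulNr.
  by apply: cvgN; apply: cvgM.
split; [|split => //].
- move=> l /andP[l0' ll0].
  have [K0 _ eig _] : P l (K l).
    by apply: Hl0 => //=; rewrite sub0r normrN gtr0_norm.
  by split => //; rewrite oppr_lt0 exprn_gt0.
(* The eigenvalue tends to 0 as the product of the convergent ratio and its denominator, which tends
   to 0 and is nonzero for small [l]. *)
- have z : (l ^+ 2 * (alpha l - a) ^+ 2) @[l --> 0^'+] --> ((0 : R) ^+ 2 * (a - a) ^+ 2).
    apply: cvgM.
      have -> : (fun l : R => l ^+ 2) = (fun l => l * l) by apply/funext => l; rewrite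
          expr2.
      by rewrite expr2; apply: cvgM; apply: cvg_at_right_filter; exact: cvg_id.
    have -> : (fun l : R => (alpha l - a) ^+ 2) = (fun l => (alpha l - a) * (alpha l -
        a)).
      by apply/funext => l; rewrite expr2.
    by rewrite expr2; apply: cvgM; (apply: cvgB; [exact: alpha_a|exact: cvg_cst]).
  have : (- K l ^+ 2 / (l ^+ 2 * (alpha l - a) ^+ 2) * (l ^+ 2 * (alpha l - a) ^+ 2))
      @[l --> 0^'+] --> - (a / (theta ^+ 2 + 1) * J) ^+ 2 * (0 ^+ 2 * (a - a) ^+ 2).
    exact: cvgM.
  rewrite expr0n/= mul0r mulr0; apply: cvg_trans; apply: near_eq_cvg; near=> l.
  have [l0' _ d0 _ _] : [/\ 0 < l, l <= 1, 0 < alpha l - a, alpha l - a <= 1 & l <= 1 *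
      (alpha l - a)].
    by near: l; exact: near_coupling.
  by rewrite /= divfK// gt_eqF// mulr_gt0// exprn_gt0.
Unshelve. all: by end_near. Qed.
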